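(* Let $M=\{1^{k_1},2^{k_2},\ldots,n^{k_n}\}$ be a multiset with $n\ge1$ and $k_1,\ldots,k_n$ positive integers, and let $K=k_1+\cdots+k_n$. Then $$p(\mathbf{t};\overline{Q}_M)=p(\mathbf{t};n,K-n+1).$$ Furthermore, let $\bar{W}_n(\mathbf{t})$ be the function of $t_1,\ldots,t_n$ determined by the expansion $$1-\sum_{n=1}^\infty\bar{W}_n(\mathbf{t})z^n=\left(1+\sum_{n=1}^\infty t_1^nt_2^{n-1}\cdots t_n\,z^n\right)^{-1}.$$ Then $p(\mathbf{t};n,k)$ satisfies the recurrence $$p(\mathbf{t};n,k)=\sum_{m=1}^n\bar{W}_m(\mathbf{t})\left(\binom{n-1}{m}p(\mathbf{t};n-m,k)+\binom{n-1}{m-1}p(\mathbf{t};n-m+1,k-1)\right)$$ for $n\ge1$ and $k\ge1$, together with $p(\mathbf{t};n,0)=p(\mathbf{t};n-1,1)$ for $n\ge2$, and the initial conditions $p(\mathbf{t};1,0)=1$ and $p(\mathbf{t};n,k)=0$ whenever $n\le0$ or $k<0$. Let $\bar{\mathcal{W}}(\mathbf{t};x)=\sum_{n=1}^\infty\bar{W}_n(\mathbf{t})x^n/n!$. Then the exponential generating function $\mathcal{P}(\mathbf{t};x,y)=\sum_{n\ge1,\,k\ge0}\frac{p(\mathbf{t};n,k)}{(n-1)!}x^ny^k$ is given by $$\mathcal{P}(\mathbf{t};x,y)=\frac{x}{1-\bar{\mathcal{W}}(\mathbf{t};x)-y\cdot\bar{\mathcal{W}}'(\mathbf{t};x)},$$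 where the prime denotes differentiation with respect to $x$.
   Context: $\{1^{k_1},\ldots,n^{k_n}\}$ denotes the multiset containing $k_\ell$ copies of the letter $\ell$ for each $\ell\in\{1,\ldots,n\}$; exponents equal to $1$ are omitted. A permutation (multipermutation) of $M$ is a word $\pi=\pi_1\cdots\pi_{|M|}$ in which each letter $\ell$ occurs exactly $k_\ell$ times; $S_M$ is the set of all of them. It is quasi-Stirling if there are no indices $j_1<j_2<j_3<j_4$ with $\pi_{j_1}=\pi_{j_3}$, $\pi_{j_2}=\pi_{j_4}$ and $\pi_{j_1}\ne\pi_{j_2}$. $\overline{Q}_M$ is the set of quasi-Stirling permutations of $M$. For $s\ge1$, $(\underline{s\cdots21})\pi$ is the number of indices $j$ such that $1\le j\le|M|-s+1$ and $\pi_j>\pi_{j+1}>\cdots>\pi_{j+s-1}$ (so $(\underline{1})\pi=|M|$). With indeterminates $\mathbf{t}=(t_1,t_2,\ldots)$, define $$p(\mathbf{t};\overline{Q}_M)=\sum_{\pi\in\overline{Q}_M}t_1^{(\underline{1})\pi}t_2^{(\underline{21})\pi}\cdots t_n^{(\underline{n\cdots21})\pi},$$ and for $n\ge1$, $k\ge0$, with $M'=\{1^k,2,\ldots,n\}$, $$p(\mathbf{t};n,k)=\sum_{\pi\in S_{M'}}t_1^{(\underline{1})\pi}t_2^{(\underline{21})\pi}\cdots t_n^{(\underline{n\cdots21})\pi}$$ (for $n=1,k=0$ the only permutation is the empty word); $p(\mathbf{t};n,k)$ is set to $0$ if $n\le0$ or $k<0$. All generating functions are formal power series. *)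

(* Defs.v *)
From HB Require Import structures.
From mathcomp Require Import all_boot all_order all_algebra.
From mathcomp Require Import boolp.
From mathcomp Require Import monalg.

Set Implicit Arguments.
Unset Strict Implicit.
Unset Printing Implicit Defensive.

Import GRing.Theory.
Local Open Scope ring_scope.

Record fps (R : Type) := Fps { fps_coef : nat -> R }.

Notation "\fps_ n E" := (Fps (fun n : nat => E))
  (at level 36, n name, E at level 36, format "\fps_ n  E").

HB.instance Definition _ (R : Type) := [isNew for @fps_coef R].
HB.instance Definition _ (R : choiceType) := [Choice of fps R by <:].

Section FpsRing.
Variable R : comNzRingType.
Implicit Types f g h : fps R.

Lemma fpsP f g : (forall n, fps_coef f n = fps_coef g n) -> f = g.
Proof. by case: f g => [f] [g] /= /funext ->. Qed.

Definition fps_add f g := \fps_n (fps_coef f n + fps_coef g n).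
Definition fps_opp f := \fps_n (- fps_coef f n).
Definition fps_mul f g :=
  \fps_n (\sum_(i < n.+1) fps_coef f i * fps_coef g (n - i)).
Definition fpsC (c : R) := \fps_n (if n == 0%N then c else 0).
Definition fpsX : fps R := \fps_n (n == 1%N)%:R.
Definition fps_deriv f := \fps_n (fps_coef f n.+1 *+ n.+1).

Fact fps_addA : associative fps_add.
Proof. by move=> f g h; apply: fpsP => n /=; rewrite addrA. Qed.
Fact fps_addC : commutative fps_add.
Proof. by move=> f g; apply: fpsP => n /=; rewrite addrC. Qed.
Fact fps_add0 : left_id (fpsC 0) fps_add.
Proof. by move=> f; apply: fpsP => n /=; rewrite if_same add0r. Qed.
Fact fps_addN : left_inverse (fpsC 0) fps_opp fps_add.
Proof. by move=> f; apply: fpsP => n /=; rewrite if_same addNr. Qed.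

HB.instance Definition _ := GRing.isZmodule.Build (fps R)
  fps_addA fps_addC fps_add0 fps_addN.

Fact fps_mulC : commutative fps_mul.
Proof.
move=> f g; apply: fpsP => n /=; rewrite (reindex_inj rev_ord_inj) /=.
by apply: eq_bigr => i _; rewrite subSS mulrC subKn ?leq_ord.
Qed.

Let coef_rev f g n : fps_coef (fps_mul f g) n =
  \sum_(i < n.+1) fps_coef f (n - i) * fps_coef g i.
Proof. by rewrite fps_mulC /=; apply: eq_bigr => i _; rewrite mulrC. Qed.

Fact fps_mulA : associative fps_mul.
Proof.
move=> p q r; apply: fpsP=> i; rewrite [RHS]coef_rev.
pose coef3 j k := fps_coef p j * (fps_coef q (i - j - k) * fps_coef r k).
transitivity (\sum_(j < i.+1) \sum_(k < i.+1 | (k <= i - j)%N) coef3 j k).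
  apply: eq_bigr => j _; rewrite coef_rev big_distrr /=.
  by rewrite (big_ord_narrow_leq (leq_subr _ _)).
rewrite (exchange_big_dep predT) //=; apply: eq_bigr => k _.
transitivity (\sum_(j < i.+1 | (j <= i - k)%N) coef3 j k).
  apply: eq_bigl => j; rewrite -ltnS -(ltnS j) -!subSn ?leq_ord //.
  by rewrite -subn_gt0 -(subn_gt0 j) -!subnDA addnC.
rewrite (big_ord_narrow_leq (leq_subr _ _)) big_distrl /=.
by apply: eq_bigr => j _; rewrite /coef3 -!subnDA addnC mulrA.
Qed.

Fact fps_mul1 : left_id (fpsC 1) fps_mul.
Proof.
move=> f; apply: fpsP => n /=; rewrite big_ord_recl /= subn0 mul1r.
by rewrite big1 ?addr0 // => i _; rewrite mul0r.
Qed.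

Fact fps_mulDl : left_distributive fps_mul fps_add.
Proof.
move=> f g h; apply: fpsP => n /=; rewrite -big_split /=.
by apply: eq_bigr => i _; rewrite mulrDl.
Qed.

Fact fps_1_neq0 : fpsC 1 != 0.
Proof. by apply/eqP => /(congr1 (@fps_coef R ^~ 0%N)) /eqP; rewrite oner_eq0. Qed.

HB.instance Definition _ := GRing.Zmodule_isComNzRing.Build (fps R)
  fps_mulA fps_mulC fps_mul1 fps_mulDl fps_1_neq0.

(* R is an arbitrary commutative ring, possibly without decidable units, so
   units and inverses of R[[z]] are obtained classically; fps_unitP below
   characterizes the units by their constant coefficient. *)
Definition fps_unit : pred (fps R) := fun f => `[< exists g, g * f = 1 >].
Definition fps_inv f :=
  if pselect (exists g, g * f = 1) is left ex_g then projT1 (cid ex_g) else f.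

Fact fps_mulV : {in fps_unit, left_inverse 1 fps_inv *%R}.
Proof.
move=> f /asboolP Uf; rewrite /fps_inv; case: pselect => // ex_g.
by case: cid.
Qed.
Fact fps_unitPl f g : g * f = 1 -> fps_unit f.
Proof. by move=> gf1; apply/asboolP; exists g. Qed.
Fact fps_inv_out : {in [predC fps_unit], fps_inv =1 id}.
Proof.
move=> f nUf; rewrite /fps_inv; case: pselect => // ex_g.
by case/negP: nUf; apply/asboolP.
Qed.

HB.instance Definition _ := GRing.ComNzRing_hasMulInverse.Build (fps R)
  fps_mulV fps_unitPl fps_inv_out.

Lemma fps_unitP f :
  reflect (exists c, c * fps_coef f 0 = 1) (f \is a GRing.unit).
Proof.
apply: (iffP idP) => [/asboolP[g /(congr1 (@fps_coef R ^~ 0%N)) /=] | [c cf1]].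
  by rewrite big_ord1 subnn => gf1; exists (fps_coef g 0).
(* s n lists the first n coefficients of the inverse *)
pose next s := - c * \sum_(i < size s) s`_i * fps_coef f (size s - i).
pose s n := iter n (fun s => rcons s (next s)) [:: c].
have size_s n : size (s n) = n.+1 by elim: n => //= n IHn; rewrite size_rcons IHn.
have s_nth n i : (i <= n)%N -> (s n)`_i = (s i)`_i.
  elim: n => [|n IHn]; first by rewrite leqn0 => /eqP->.
  rewrite leq_eqVlt => /predU1P[->//|lt_in].
  by rewrite /= nth_rcons size_s lt_in IHn.
apply/asboolP; exists (\fps_n (s n)`_n); apply: fpsP => -[|n] /=.
  by rewrite big_ord1.
rewrite big_ord_recr /= subnn nth_rcons size_s ltnn eqxx /next size_s.
rewrite mulrAC mulNr cf1 mulN1r; apply/eqP; rewrite subr_eq0; apply/eqP.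
by apply: eq_bigr => i _; rewrite (@s_nth n) // -ltnS.
Qed.

End FpsRing.

Arguments fpsX {R}.

(* The polynomial ring Q[t_0, t_1, t_2, ...]; t_0 is not used. *)

Notation tpoly := {malg rat[{cmonom nat}]}.
Definition tvar (s : nat) : tpoly := << ucm s >>.

(* The letters 1 < ... < n are represented by 0 < ... < n-1 in 'I_n,
   and the multiset {1^{k_1}, ..., n^{k_n}} by the function k : 'I_n -> nat. *)

Definition multiperms n (k : 'I_n -> nat) :
    {set (\sum_(l < n) k l)%N.-tuple 'I_n} :=
  [set w | [forall l, count_mem l (val w) == k l]].

Definition quasi_stirling n N (w : N.-tuple 'I_n) : bool :=
  ~~ [exists j1 : 'I_N, exists j2 : 'I_N, exists j3 : 'I_N, exists j4 : 'I_N,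
        [&& (j1 < j2)%N, (j2 < j3)%N, (j3 < j4)%N, tnth w j1 == tnth w j3,
            tnth w j2 == tnth w j4 & tnth w j1 != tnth w j2]].

Definition qs_multiperms n (k : 'I_n -> nat) :=
  [set w in multiperms k | quasi_stirling w].

(* The number of occurrences of the consecutive pattern s...21 in w; the
   starting positions are the j with 0 <= j <= |w| - s, none if s > |w|. *)
Definition consec_desc n (s : nat) (w : seq 'I_n) : nat :=
  \sum_(0 <= j < (size w).+1 - s)
     sorted (fun a b : 'I_n => (b < a)%N) (take s (drop j w)).

Definition desc_weight n (w : seq 'I_n) : tpoly :=
  \prod_(1 <= s < n.+1) tvar s ^+ consec_desc s w.

Definition p_qs n (k : 'I_n -> nat) : tpoly :=
  \sum_(w in qs_multiperms k) desc_weight w.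

(* {1^k, 2, ..., n} with n = n'.+1 *)
Definition one_repeated n' (k : nat) (l : 'I_n'.+1) : nat :=
  if l == ord0 then k else 1%N.

Definition p_one (n k : int) : tpoly :=
  match n, k with
  | Posz n'.+1, Posz k' =>
      \sum_(w in multiperms (@one_repeated n' k')) desc_weight w
  | _, _ => 0
  end.

Definition Tseries : fps tpoly :=
  \fps_n (if n == 0%N then 0
          else \prod_(1 <= i < n.+1) tvar i ^+ (n.+1 - i)).

Definition Wbar (n : nat) : tpoly := - fps_coef (1 + Tseries)^-1 n.

(* The value at n = 0 is irrelevant: the sum defining W starts at n = 1. *)
Lemma WbarE : 1 - \fps_n (if n == 0%N then 0 else Wbar n) = (1 + Tseries)^-1.
Proof.
have U : 1 + Tseries \is a GRing.unit.
  by apply/fps_unitP; exists 1; rewrite /= addr0 mulr1.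
have := mulVr U => /(congr1 (@fps_coef _ ^~ 0%N)) /=.
rewrite big_ord1 /= addr0 mulr1 => inv0.
by apply: fpsP => -[|n] /=; rewrite ?subr0 ?inv0 // sub0r opprK.
Qed.

Definition Wegf : fps tpoly :=
  \fps_n (if n == 0%N then 0 else (n`!%:R^-1 : rat) *: Wbar n).

(* Q[t][[x]][[y]]: the coefficient of x^n y^k in F is
   fps_coef (fps_coef F k) n. *)
Definition Pegf : fps (fps tpoly) :=
  \fps_k (\fps_n (if n == 0%N then 0
                  else ((n.-1)`!%:R^-1 : rat) *: p_one n k)).
Definition xvar : fps (fps tpoly) := fpsC fpsX.
Definition yvar : fps (fps tpoly) := fpsX.

Lemma egf_den_unit :
  1 - fpsC Wegf - yvar * fpsC (fps_deriv Wegf) \is a GRing.unit.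
Proof.
have U : 1 - Wegf \is a GRing.unit.
  by apply/fps_unitP; exists 1; rewrite /= subr0 mulr1.
apply/fps_unitP; exists (1 - Wegf)^-1.
by rewrite /= big_ord1 /= mul0r subr0 mulVr.
Qed.

(* Main.v *)
Require Import Defs.
From mathcomp Require Import all_boot all_order all_fingroup all_algebra.
From mathcomp Require Import monalg.
From mathcomp Require Import zify ring.

(** A word splits into maximal decreasing runs, and its weight is the product
of [run_weight r = t_1^r t_2^(r-1) ... t_r] over the sizes [r] of its runs.
Since [1 - W] is the inverse of the series of the run weights, a run weight is
the sum over the compositions of [r] of the products of the [Wbar m].  So the
weight of a word is the sum, over its factorizations into decreasing blocks, of
the product of [Wbar] over the block sizes, and a decreasing block is just a set
of letters.  Sorting by the first block gives the recurrence for the words on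
[1^k, 2, ..., n] ([p_nat_rec]): a first block of size [m] avoids the repeated
letter in [C(n-1, m)] ways and contains it in [C(n-1, m-1)] ways.  The generating
function is this recurrence read on coefficients ([Pegf_eq]).

For the first identity, quasi-Stirling means noncrossing, and every word on
[1^k, 2, ..., n] is noncrossing.  It remains to see that the sum over the
noncrossing words does not change when copies of one letter are replaced by
copies of another one, as long as every letter keeps at least one copy.
Two facts suffice.

Symmetry ([noncrossing_sum_swap]): the multiplicities of two consecutive letters
[a = b+1] can be exchanged.  The weight depends only on the descent set, so it is
enough to count, for each list [J] of positions, the noncrossing words that
descend at every position of [J].  If no position of [J] carries the factor [ab],
exchanging the letters [a] and [b] keeps all these descents.  Otherwise exactly
one position does.  Rotate the word to start with this [b] and end with this [a]:
noncrossing puts every [b] before every [a], and stays true if both letters are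
merged.  The word is therefore determined by the merged word and the number of
[b], and that number can be chosen freely.

Transfer ([noncrossing_sum_transfer]): if the smallest letter [x] occurs at least
twice, the factor between two consecutive [x] uses letters that occur nowhere
else, and removing it splits off a factor of the weight, because [x] ends a run.
So the sum is a convolution over sets of letters ([noncrossing_sum_peel]).
Applied to the smallest letter [c], and to the second smallest letter [a] in the
words followed by one [c], this expresses the sums with [p] copies of [a] and
[q] copies of [c] through each other, and symmetry starts the induction that
shows that they depend on [p + q] only.  Repeating swaps and transfers brings
every content to [one_repeated] ([noncrossing_sum_canonical]). *)

Set Implicit Arguments.
Unset Strict Implicit.
Unset Printing Implicit Defensive.

Import GRing.Theory.
Local Open Scope ring_scope.

(** * Noncrossing words *)

Lemma big_seq_bij (R : nmodType) (A B : eqType) (s : seq A) (t : seq B)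
    (f : A -> B) (g : B -> A) (F : A -> R) (G : B -> R) :
  uniq s -> uniq t ->
  {in s, forall x, [/\ f x \in t, g (f x) = x & F x = G (f x)]} ->
  {in t, forall y, g y \in s /\ f (g y) = y} ->
  \sum_(x <- s) F x = \sum_(y <- t) G y.
Proof.
move=> us ut fP gP.
have ft : perm_eq (map f s) t.
  apply: uniq_perm => //.
    rewrite map_inj_in_uniq // => x y /fP[_ gx _] /fP[_ gy _] fxy.
    by rewrite -gx fxy gy.
  move=> y; apply/mapP/idP => [[x /fP[xt _ _] -> //]|/gP[gys fgy]].
  by exists (g y).
rewrite -(perm_big _ ft) big_map; apply: eq_big_seq => x /fP[_ _ ->] //.
Qed.

Section Words.
Variable T : finType.
Implicit Types (k : T -> nat) (w u v : seq T).

Definition letters k : seq T := flatten [seq nseq (k l) l | l <- enum T].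

Lemma count_letters k l : count_mem l (letters k) = k l.
Proof.
rewrite /letters count_flatten -map_comp.
rewrite (eq_map (g := fun x => (x == l) * k x)%N) => [|x]; last first.
  by rewrite /= count_nseq /=.
rewrite sumnE big_map big_enum /= (bigD1 l) //= eqxx mul1n big1 ?addn0 //.
by move=> x /negPf ->.
Qed.

Lemma size_letters k : size (letters k) = (\sum_l k l)%N.
Proof.
rewrite /letters size_flatten /shape -map_comp sumnE big_map big_enum /=.
by apply: eq_bigr => l _; rewrite size_nseq.
Qed.

Definition words k : seq (seq T) := permutations (letters k).

Lemma words_uniq k : uniq (words k).
Proof. exact: permutations_uniq. Qed.

Lemma wordsP k w : reflect (forall l, count_mem l w = k l) (w \in words k).
Proof.
rewrite mem_permutations; apply: (iffP idP) => [/seq.permP kw l|kw].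
  by rewrite kw count_letters.
by apply/allP => l _ /=; rewrite kw count_letters.
Qed.

Lemma words_size k w : w \in words k -> size w = (\sum_l k l)%N.
Proof. by rewrite mem_permutations => /perm_size ->; apply: size_letters. Qed.

Lemma mem_words k w l : w \in words k -> (l \in w) = (0 < k l)%N.
Proof. by move=> /wordsP <-; rewrite -has_count has_pred1. Qed.

(** The crossing letters may be looked for as a subsequence, which has no
positions: this makes the notion easy to follow through cuts and rotations. *)
Definition noncrossing w : bool :=
  [forall y, forall z, (y != z) ==> ~~ subseq [:: y; z; y; z] w].

Lemma noncrossingP w :
  reflect (forall y z, y != z -> ~~ subseq [:: y; z; y; z] w) (noncrossing w).
Proof.
apply: (iffP forallP) => [nc y z yz|nc y];
    first by move/forallP: (nc y) => /(_ z)/implyP; apply.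
by apply/forallP => z; apply/implyP; apply: nc.
Qed.

Lemma noncrossing_subseq u w : subseq u w -> noncrossing w -> noncrossing u.
Proof.
move=> uw /noncrossingP nc; apply/noncrossingP => y z /nc.
by apply: contra => /subseq_trans; apply.
Qed.

Lemma subseq_catP u v w : subseq u (v ++ w) ->
  exists u1 u2, [/\ u = u1 ++ u2, subseq u1 v & subseq u2 w].
Proof.
case/subseqP=> m sm ->; exists (mask (take (size v) m) v), (mask (drop (size v) m) w).
rewrite -mask_cat ?cat_take_drop ?mask_subseq //.
by rewrite size_takel // sm size_cat leq_addr.
Qed.

(** A rotation turns a pattern [yzyz] into [yzyz] or [zyzy]. *)
Lemma noncrossing_rot u v : noncrossing (u ++ v) -> noncrossing (v ++ u).
Proof.
move=> /noncrossingP nc; apply/noncrossingP => y z yz; apply/negP.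
move=> /subseq_catP[t1 [t2 [E t1v t2u]]].
have := cat_subseq t2u t1v; have zy : z != y by rewrite eq_sym.
have := nc y z yz; have := nc z y zy.
case: t1 E {t1v t2u} => [|a [|b [|c [|d [|e t1]]]]] //=.
- by move=> <-; rewrite cats0 => _ /negP.
- by move=> [-> <-] /= /negP.
- by move=> [-> -> <-] /= _ /negP.
- by move=> [-> -> -> <-] /= /negP.
- by move=> [-> -> -> -> <-] /= _ /negP.
Qed.

Lemma subseq_skipl y t u v :
  y \notin u -> subseq (y :: t) (u ++ v) -> subseq (y :: t) v.
Proof.
elim: u => //= x u IH; rewrite inE negb_or => /andP[/negPf->]; exact: IH.
Qed.

Lemma subseq_skipr y t u v :
  y \notin v -> subseq (rcons t y) (u ++ v) -> subseq (rcons t y) u.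
Proof.
rewrite -subseq_rev -(subseq_rev _ u) rev_cat rev_rcons => yv.
by apply: subseq_skipl; rewrite mem_rev.
Qed.

(** A crossing of the new word involves two letters of [u], two letters of
[v1 ++ v2], or one of each; in the last case the two occurrences of the letter
of [u] lie in the factor [u], which leaves no room for the other letter. *)
Lemma noncrossing_insert u v1 v2 :
  {in u, forall y, y \notin v1 ++ v2} -> noncrossing u ->
  noncrossing (v1 ++ v2) -> noncrossing (v1 ++ u ++ v2).
Proof.
move=> dj /noncrossingP ncu /noncrossingP ncv.
have within y z : y \in u -> subseq [:: y; z; y] (v1 ++ u ++ v2) ->
    subseq [:: y; z; y] u.
  move=> /dj; rewrite mem_cat negb_or => /andP[yv1 yv2] /(subseq_skipl yv1).
  exact: (@subseq_skipr y [:: y; z]).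
have inu t y : y \in t -> subseq t u -> y \in u by move=> yt /mem_subseq; apply.
apply/noncrossingP => y z yz; apply/negP => yzyz.
have [yu|yu] := boolP (y \in u); have [zu|zu] := boolP (z \in u).
- have : subseq (filter (mem u) [:: y; z; y; z]) (filter (mem u) (v1 ++ u ++ v2)).
    by rewrite subseq_filter filter_all (subseq_trans (filter_subseq _ _)).
  have v0 v : {in v, forall x, x \notin u} -> filter (mem u) v = [::].
    move=> vP; apply/eqP; rewrite -(negbK (_ == _)) -has_filter.
    by apply/hasPn.
  have v1P : {in v1, forall x, x \notin u}.
    by move=> x xv; apply/negP => /dj; rewrite mem_cat xv.
  have v2P : {in v2, forall x, x \notin u}.
    by move=> x xv; apply/negP => /dj; rewrite mem_cat xv orbT.
  have uE : filter (mem u) u = u by apply/all_filterP/allP.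
  rewrite !filter_cat uE (v0 v1) // (v0 v2) // cats0 /= yu zu /=.
  by apply/negP/ncu.
- case/negP: zu; apply: (inu [:: y; z; y]); first by rewrite !inE eqxx orbT.
  apply: within => //; apply: subseq_trans yzyz.
  exact: (@prefix_subseq _ [:: y; z; y] [:: z]).
- case/negP: yu; apply: (inu [:: z; y; z]); first by rewrite !inE eqxx orbT.
  by apply: within => //; apply: subseq_trans yzyz; apply: subseq_cons.
- have : subseq (filter (predC (mem u)) [:: y; z; y; z])
      (filter (predC (mem u)) (v1 ++ u ++ v2)).
    by rewrite subseq_filter filter_all (subseq_trans (filter_subseq _ _)).
  rewrite !filter_cat /= yu zu /= (_ : filter _ u = [::]) /= => [s4|].
    case/negP: (ncv _ _ yz); apply: subseq_trans s4 _.
    by apply: cat_subseq; apply: filter_subseq.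
  by apply/eqP; rewrite -(negbK (_ == _)) -has_filter; apply/hasPn => x /= ->.
Qed.

(** The pattern [yzyz] has no two equal neighbours, so it cannot use both
copies of [x]. *)
Lemma noncrossing_double v1 x v2 :
  noncrossing (v1 ++ x :: v2) -> noncrossing (v1 ++ x :: x :: v2).
Proof.
have dbl t : sorted (fun a b => a != b) t -> subseq t (v1 ++ x :: x :: v2) ->
    subseq t (v1 ++ x :: v2).
  elim: v1 t => [|a v1 IH] [|y t] //= srt; last first.
    by case: ifP => _; apply: IH => //; apply: path_sorted srt.
  have [yx|/negPf->//] := eqVneq y x; case: t srt => [|z t] /= srt;
      first by rewrite sub0seq.
  by case: eqP => // zx _; move: srt; rewrite yx zx eqxx.
move=> /noncrossingP nc; apply/noncrossingP => y z yz; apply: contra (nc y z yz).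
by apply: dbl; rewrite /= yz eq_sym yz.
Qed.

End Words.

(** * Exchanging the multiplicities of two consecutive letters *)

Section Relabel.
Variables (T : finType) (a b : T).
Hypothesis neq_ab : a != b.
Implicit Types (s r w : seq T).

Definition merge_ab (x : T) := if x == a then b else x.

(** The inverse of merging [a] and [b], once the number of [b] is prescribed and
all of them have to come before the [a]. *)
Fixpoint relabel m s :=
  if s is x :: s' then
    if x \in [:: a; b] then
      if m is m'.+1 then b :: relabel m' s' else a :: relabel 0 s'
    else x :: relabel m s'
  else [::].

Lemma merge_relabel m s : map merge_ab (relabel m s) = map merge_ab s.
Proof.
elim: s m => //= x s IH m; case: ifP => [|_] /=; last by rewrite IH.
rewrite !inE /merge_ab; case: m => [|m] /=;
    rewrite IH ?eqxx ?(eq_sym b) ?(negPf neq_ab).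
  by case: eqP => //= _ /eqP ->.
by case: eqP => //= _ /eqP ->.
Qed.

Lemma relabel_merge m s : relabel m (map merge_ab s) = relabel m s.
Proof.
have mem_merge y : (merge_ab y \in [:: a; b]) = (y \in [:: a; b]).
  by rewrite !inE /merge_ab; have [|/negPf->] := eqVneq y a; rewrite ?eqxx ?orbT.
elim: s m => //= x s IH m; rewrite mem_merge; case: ifP => [_|].
  by case: m => [|m]; rewrite IH.
by rewrite !inE IH /merge_ab => /norP[/negPf->].
Qed.

Lemma relabel0_id s : b \notin s -> relabel 0 s = s.
Proof.
elim: s => //= x s IH; rewrite !inE negb_or => /andP[bx /IH->].
by rewrite orbC eq_sym (negPf bx) /=; case: eqP => // ->.
Qed.

Lemma relabel_id s : ~~ subseq [:: a; b] s -> relabel (count_mem b s) s = s.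
Proof.
elim: s => //= x s IH; rewrite !inE; have [->|xa] := eqVneq x a.
  rewrite (negPf neq_ab) ?eqxx sub1seq add0n /= => bs.
  by rewrite (count_memPn bs) relabel0_id.
move=> /IH {}IH.
by case: eqVneq => [->|_]; rewrite ?add1n ?add0n IH.
Qed.

Lemma relabel0_notin s : b \notin relabel 0 s.
Proof.
elim: s => //= x s IH; rewrite !inE orbC; have [//|/= xb] := eqVneq x b.
  by rewrite /= inE negb_or eq_sym neq_ab.
by case: eqVneq => _; rewrite inE negb_or IH ?andbT eq_sym.
Qed.

Lemma relabel_sorted m s : ~~ subseq [:: a; b] (relabel m s).
Proof.
elim: s m => //= x s IH m; case: ifP => [_|] /=.
  case: m => [|m] /=; last by rewrite (negPf neq_ab).
  by rewrite eqxx sub1seq relabel0_notin.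
by rewrite !inE eq_sym; case: eqVneq => //=.
Qed.

Lemma count_relabel_b m s :
  count_mem b (relabel m s) = minn m (count (mem [:: a; b]) s).
Proof.
elim: s m => [|x s IH] m /=; first by rewrite minn0.
rewrite /= !inE; case: ifP => [_|] /=.
  by case: m => [|m] /=; rewrite IH ?(negPf neq_ab) ?eqxx ?min0n // add1n minnSS.
by rewrite IH orbC; case: eqVneq.
Qed.

Lemma count_ab s : count (mem [:: a; b]) s = (count_mem a s + count_mem b s)%N.
Proof.
elim: s => //= x s ->; rewrite !inE; case: eqVneq => [->|_] /=.
  by rewrite (negPf neq_ab) add0n addnA.
by rewrite add0n addnCA.
Qed.

Lemma count_merge_ab s :
  count_mem b (map merge_ab s) = count (mem [:: a; b]) s.
Proof.
elim: s => //= x s ->; rewrite /merge_ab !inE.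
by have [->|/negPf xa] := eqVneq x a; rewrite ?xa ?eqxx.
Qed.

Lemma count_relabel_a m s :
  count_mem a (relabel m s) = (count (mem [:: a; b]) s - m)%N.
Proof.
have : count (mem [:: a; b]) (relabel m s) = count (mem [:: a; b]) s.
  by rewrite -count_merge_ab merge_relabel count_merge_ab.
rewrite {1}count_ab count_relabel_b; lia.
Qed.

Lemma count_merge_other c s : c \notin [:: a; b] ->
  count_mem c (map merge_ab s) = count_mem c s.
Proof.
rewrite !inE negb_or => /andP[ca cb]; elim: s => //= x s ->; rewrite /merge_ab.
by have [->|//] := eqVneq x a; rewrite eq_sym (negPf cb) eq_sym (negPf ca).
Qed.

Lemma count_relabel_other c m s : c \notin [:: a; b] ->
  count_mem c (relabel m s) = count_mem c s.
Proof. by move=> cab; rewrite -count_merge_other // merge_relabel count_merge_other.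
    Qed.

Lemma relabel_rcons m s : (m <= count (mem [:: a; b]) s)%N ->
  relabel m (rcons s a) = rcons (relabel m s) a.
Proof.
elim: s m => [|x s IH] m /=; first by rewrite leqn0 => /eqP->; rewrite inE eqxx.
rewrite !inE; case: ifP => _ /=; last by rewrite add0n => /IH ->.
by case: m => [|m]; [rewrite IH|rewrite add1n ltnS => /IH ->].
Qed.

(** If [r] starts with [b] and ends with [a], merging the two letters creates no
crossing: an occurrence of [a] or [b] that crosses with another letter could be
completed, by the initial [b] or by the final [a], to a crossing of [r].  Hence
every word with the same merged word and no [a] before a [b] is noncrossing. *)
Lemma noncrossing_relabel r s0 s1 r' :
  r = b :: s0 -> r = rcons s1 a -> noncrossing r ->
  map merge_ab r' = map merge_ab r -> ~~ subseq [:: a; b] r' ->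
  noncrossing r'.
Proof.
move=> rb ra /noncrossingP nc mr sr'; apply/noncrossingP => y z yz; apply/negP => s4.
have neq_ba : b != a by rewrite eq_sym.
have sub2 x1 x2 : x1 \in [:: a; b] -> x2 \in [:: a; b] -> x1 != x2 ->
    subseq [:: x1; x2; x1; x2] r' -> False.
  rewrite !inE => /orP[]/eqP-> /orP[]/eqP->; rewrite ?eqxx // => _ {}s4;
    case/negP: sr'; apply: subseq_trans s4;
    by rewrite /= ?eqxx ?(negPf neq_ab) ?(negPf neq_ba) /= ?eqxx.
have cons_b t c : subseq (c :: t) r -> c != b -> subseq (b :: c :: t) r.
  by rewrite rb /= eqxx => /[swap] /negPf->.
have cons_b1 t x c : subseq (x :: c :: t) r -> c != b -> subseq (b :: c :: t) r.
  move=> xct cb; apply: cons_b => //; apply: subseq_trans xct; exact: subseq_cons.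
have cons_a t c : subseq (rcons t c) r -> c != a -> subseq (rcons (rcons t c) a) r.
  rewrite ra -subseq_rev -(subseq_rev (rcons (rcons t c) a)) !rev_rcons /= eqxx.
  by move=> /[swap] /negPf->.
(* [t] lies in [r] where the crossing lies in [r']. *)
have [t tE st] : exists2 t, map merge_ab [:: y; z; y; z] = map merge_ab t & subseq t r.
  have := map_subseq merge_ab s4; rewrite mr => /subseqP[m _ ->].
  by rewrite -map_mask; eexists; [reflexivity|exact: mask_subseq].
have mab x x' : x \in [:: a; b] -> merge_ab x = merge_ab x' -> x' = b \/ x' = a.
  rewrite /merge_ab !inE => /orP[]/eqP->; rewrite ?eqxx 1?eq_sym ?(negPf neq_ab);
  by case: eqP => [->|]; auto.
have mo x x' : x \notin [:: a; b] -> merge_ab x = merge_ab x' -> x' = x.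
  rewrite /merge_ab !inE negb_or => /andP[/negPf-> xb].
  by case: eqP => // _ E; rewrite E eqxx in xb.
case: t tE st => [|t1 [|t2 [|t3 [|t4 [|]]]]] //= [e1 e2 e3 e4] st.
have [yab|yab] := boolP (y \in [:: a; b]); have [zab|zab] := boolP (z \in [:: a; b]).
- exact: (sub2 y z).
- have [E2 E4] := (mo _ _ zab e2, mo _ _ zab e4); rewrite {}E2 {}E4 in st.
  move: zab; rewrite !inE negb_or => /andP[za zb].
  have [E|E] := mab _ _ yab e3; rewrite {}E in st.
    by rewrite eq_sym in zb; case/negP: (nc _ _ zb); apply: (cons_b1 _ t1);
        rewrite // eq_sym.
  case/negP: (nc _ _ za); apply: (cons_a [:: z; a] z) => //.
  by apply: subseq_trans st; apply: subseq_cons.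
- have [E1 E3] := (mo _ _ yab e1, mo _ _ yab e3); rewrite {}E1 {}E3 in st.
  move: yab; rewrite !inE negb_or => /andP[ya yb].
  have [E|E] := mab _ _ zab e2; rewrite {}E in st.
    rewrite eq_sym in yb; case/negP: (nc _ _ yb); apply: cons_b; rewrite 1?eq_sym //.
    by apply: subseq_trans st; apply: (@prefix_subseq _ [:: y; b; y] [:: t4]).
  case/negP: (nc _ _ ya); apply: (cons_a [:: y; a] y) => //.
  by apply: subseq_trans st; apply: (@prefix_subseq _ [:: y; a; y] [:: t4]).
- rewrite (mo _ _ yab e1) (mo _ _ yab e3) (mo _ _ zab e2) (mo _ _ zab e4) in st.
  by case/negP: (nc y z yz).
Qed.

End Relabel.

Lemma eq_words (T : finType) (k1 k2 : T -> nat) : k1 =1 k2 -> words k1 = words k2.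
Proof.
move=> e; rewrite /words /letters; congr (permutations (flatten _)).
by apply: eq_map => l; rewrite e.
Qed.

Section Descents.
Variable n : nat.
Implicit Types (w u v : seq 'I_n).

(** Letters are compared as numbers, so that no default letter is needed;
positions beyond the end are not descents. *)
Definition descent_at w i : bool :=
  (i.+1 < size w)%N && (nth 0 (map val w) i.+1 < nth 0 (map val w) i)%N.

Lemma descent_at_nth x0 w i :
  descent_at w i = (i.+1 < size w)%N && (nth x0 w i.+1 < nth x0 w i)%N.
Proof.
by rewrite /descent_at; case: ltnP => //= lt_iw; rewrite !(nth_map x0) // ltnW.
Qed.

Section BenderKnuth.
Variables (a b : 'I_n).
Hypothesis ab : a = b.+1 :> nat.
Let mu := merge_ab a b.

Let neq_ab : a != b.
Proof. by apply/eqP => E; move: ab; rewrite E; lia. Qed.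

(** The factor [ab], the only descent between two letters of [{a, b}], is the
only one that an exchange of [a] and [b] can destroy. *)
Definition junction w j : bool :=
  [&& (j.+1 < size w)%N, nth a w j == a & nth a w j.+1 == b].

Lemma junctionP w j : reflect
  (exists u v, w = rcons u a ++ b :: v /\ size u = j) (junction w j).
Proof.
apply: (iffP and3P) => [[jw /eqP ja /eqP jb]|[u [v [-> <-]]]].
  exists (take j w), (drop j.+2 w); split; last by rewrite size_takel // ltnW // ltnW.
  by rewrite -{1}ja -jb -take_nth 1?ltnW // -drop_nth // cat_take_drop.
split; first by rewrite size_cat size_rcons /=; lia.
  by rewrite nth_cat size_rcons leqnn nth_rcons ltnn eqxx.
by rewrite nth_cat size_rcons ltnn subnn.
Qed.

(** With the first [b] and the last [a], a subword [ab] would give [baba]. *)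
Lemma no_ab_rotated s t : b :: s = rcons t a -> noncrossing (b :: s) ->
  ~~ subseq [:: a; b] (b :: s).
Proof.
move=> E /noncrossingP nc; apply/negP => abs.
have neq_ba : b != a by rewrite eq_sym.
have : subseq (b :: [:: a; b]) (b :: s).
  by move: abs; rewrite /= eqxx ?(negPf neq_ab) ?(negPf neq_ba).
rewrite {}E in nc *; rewrite (_ : [:: b; a; b] = rcons [:: b; a] b) // => s3.
case/negP: (nc b a neq_ba).
rewrite (_ : [:: b; a; b; a] = rcons (rcons [:: b; a] b) a) //.
move: s3; rewrite -subseq_rev -(subseq_rev (rcons (rcons _ _) a)) !rev_rcons.
by rewrite /= eqxx (negPf neq_ba).
Qed.

(** Two occurrences of the factor [ab] contain the crossing [abab]. *)
Lemma junction_uniq w i j :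
  noncrossing w -> junction w i -> junction w j -> i = j.
Proof.
move=> /noncrossingP nc; wlog lt_ij : i j / (i < j)%N => [W Ji Jj|].
  by case: (ltngtP i j) => // ij; [|symmetry]; apply: W.
move=> /junctionP[u [v [wE su]]] /and3P[jw /eqP ja /eqP jb].
case/negP: (nc a b neq_ab); rewrite wE -cats1 -catA.
apply: (@subseq_trans _ ([:: a; b] ++ v)); last first.
  by rewrite [_ ++ b :: _](_ : _ = [:: a; b] ++ v) //; apply: suffix_subseq.
rewrite (_ : [:: a; b; a; b] = [:: a; b] ++ [:: a; b]) // cat_subseq //.
have lt_ij' : (i.+1 < j)%N.
  rewrite ltn_neqAle lt_ij andbT; apply/eqP => E; move: ja.
  rewrite -E wE nth_cat size_rcons su ltnn subnn /= => /eqP.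
  by rewrite eq_sym (negPf neq_ab).
have nthv l : (i.+1 < l)%N -> nth a w l = nth a v (l - i.+2).
  move=> il; rewrite wE nth_cat size_rcons su ltnNge ltnW //=.
  by case E : (l - i.+1)%N => [|m] /=; [lia|congr nth; lia].
have szv : (j - i.+2 < (size v).-1)%N.
  by move: jw; rewrite wE size_cat size_rcons /= su; lia.
apply: subseq_trans (drop_subseq v (j - i.+2)).
rewrite (drop_nth a) ?(drop_nth a (n:=(j - i.+2).+1)); try lia.
rewrite -nthv // ja (_ : (j - i.+2).+1 = j.+1 - i.+2)%N; last lia.
by rewrite -nthv ?jb ?eqxx //= ?eqxx ?sub0seq //; lia.
Qed.

(** As [a] and [b] are consecutive, a comparison with a third letter does not
distinguish them. *)
Lemma descent_at_merge w w' i : map mu w = map mu w' -> descent_at w i ->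
  junction w i = junction w' i -> descent_at w' i.
Proof.
move=> E; have sw : size w = size w' by rewrite -(size_map mu) E size_map.
have muE l : (l < size w)%N -> mu (nth a w l) = mu (nth a w' l).
  by move=> lw; rewrite -!(nth_map a a) -?sw // E.
rewrite /junction !(descent_at_nth a) -sw => /andP[iw desc]; rewrite iw /=.
move: (muE _ iw) (muE _ (ltnW iw)) desc; rewrite /mu /merge_ab.
set x := nth a w i; set y := nth a w i.+1.
set x' := nth a w' i; set y' := nth a w' i.+1.
rewrite -!(inj_eq val_inj) /=.
have vE (p q : 'I_n) : p = q -> p = q :> nat by move=> ->.
by do 4 case: eqP => ?; move=> /vE ? /vE ?; (do ?case: eqP => ?); move=> //= *; lia.
Qed.

Variable (k : 'I_n -> nat).

(** After the rotation to the junction, every [b] comes before every [a], so the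
merged word and the number of [b] determine the word. *)
Lemma joined_inj w1 w2 j : w1 \in words k -> w2 \in words k ->
  noncrossing w1 -> noncrossing w2 -> junction w1 j -> junction w2 j ->
  map mu w1 = map mu w2 -> w1 = w2.
Proof.
move=> /wordsP k1 /wordsP k2 nc1 nc2 /junctionP[u1 [v1 [E1 s1]]].
move=> /junctionP[u2 [v2 [E2 s2]]] E.
have rotE u v w : w = rcons u a ++ b :: v -> w \in words k -> noncrossing w ->
    b :: v ++ rcons u a = relabel a b (k b) (map mu (b :: v ++ rcons u a)).
  move=> -> /wordsP /(_ b); rewrite count_cat addnC -count_cat cat_cons => <- nc.
  rewrite relabel_merge // relabel_id // (no_ab_rotated (t := b :: v ++ u)) //.
    by rewrite rcons_cons rcons_cat.
  exact: (noncrossing_rot (v := b :: v) nc).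
have : b :: v1 ++ rcons u1 a = b :: v2 ++ rcons u2 a.
  rewrite (rotE _ _ _ E1) //; last exact/wordsP.
  rewrite (rotE _ _ _ E2) //; last exact/wordsP.
  congr relabel; move: E; rewrite E1 E2 -!cat_cons !map_cat => /eqP.
  rewrite eqseq_cat ?size_map ?size_rcons ?s1 ?s2 // => /andP[/eqP e1 /eqP e2].
  by rewrite e2 e1.
move=> [] /eqP; rewrite eqseq_cat => [/andP[/eqP e1 /eqP e2]|].
  by rewrite E1 E2 e1 e2.
have : size w1 = size w2 by rewrite -(size_map mu) E size_map.
rewrite E1 E2 !size_cat !size_rcons s1 s2 /=; lia.
Qed.

(** Rotate to the junction, relabel with the other number of [b], and rotate
back; as both multiplicities are positive, the rotated word still starts with
[b] and ends with [a], so the junction is kept. *)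
Lemma joined_ex w j : w \in words k -> noncrossing w -> junction w j ->
  exists v, [/\ v \in words (fun l => k (tperm a b l)), noncrossing v, junction v j &
              map mu v = map mu w].
Proof.
move=> /wordsP kw nc /junctionP[u [v [E su]]].
set r := b :: v ++ rcons u a; set r' := relabel a b (k a) r.
have nc_r : noncrossing r by move: nc; rewrite E;
    apply: (@noncrossing_rot _ (rcons u a) (b :: v)).
have cr l : count_mem l r = k l.
  by rewrite -kw E /r -cat_cons [RHS]count_cat addnC -count_cat.
have ra : r = rcons (b :: v ++ u) a by rewrite /r rcons_cons rcons_cat.
have mr' : map mu r' = map mu r by apply: merge_relabel.
have nc_r' : noncrossing r'.
  by apply: (noncrossing_relabel neq_ab (erefl r) ra nc_r mr'); apply: relabel_sorted.
have cab : count (mem [:: a; b]) r = (k a + k b)%N by rewrite count_ab // !cr.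
have ka : (0 < k a)%N by rewrite -kw -has_count has_pred1 E mem_cat mem_rcons inE eqxx.
have kb : (0 < k b)%N by rewrite -kw -has_count has_pred1 E mem_cat inE eqxx orbT.
have [s' r'b] : exists s', r' = b :: s'.
  rewrite /r' /r /= !inE eqxx orbT /=; case: (k a) ka => // m _.
  by eexists; reflexivity.
have [t' r'a] : exists t', r' = rcons t' a.
  rewrite /r' ra relabel_rcons; first by eexists; reflexivity.
  have := cab; rewrite ra -cats1 count_cat (_ : count _ [:: a] = 1%N).
    by move=> E1; apply: (@leq_trans (k a + k b - 1)%N); [lia|rewrite -E1 addnK].
  by rewrite /= inE eqxx.
have cr' l : count_mem l r' = k (tperm a b l).
  case: tpermP => [->|->|/eqP la /eqP lb].
  - by rewrite count_relabel_a // cab addKn.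
  - by rewrite count_relabel_b // cab; apply/minn_idPl/leq_addr.
  - by rewrite count_relabel_other ?cr // !inE negb_or la.
have sr' : size r' = (size v + size u).+2.
  by rewrite -(size_map mu) mr' size_map /r /= size_cat size_rcons addnS.
pose p := take (size v).+1 r'; pose q := drop (size v).+1 r'.
have pq : r' = p ++ q by rewrite cat_take_drop.
have sp : size p = (size v).+1 by rewrite size_takel // sr' ltnS ltnW // ltnS leq_addr.
have sq : size q = (size u).+1 by rewrite size_drop sr'; lia.
clearbody p q r'; exists (q ++ p); split.
- by apply/wordsP => l; rewrite count_cat addnC -count_cat -pq cr'.
- by apply: noncrossing_rot; rewrite -pq.
- apply/junctionP; exists (take (size u) q), (behead p); split; last first.
    by rewrite size_takel ?sq ?leqnSn.
  congr (_ ++ _).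
    case/lastP: q sq pq => // q x; rewrite size_rcons => -[<-].
    by rewrite r'a -rcons_cat => /rcons_inj[_ ->];
        rewrite -cats1 take_size_cat // cats1.
  by case: p sp pq => // x p _; rewrite r'b => -[->].
have : map mu (p ++ q) = map mu ((b :: v) ++ rcons u a) by rewrite -pq mr'.
rewrite E !map_cat => /eqP; rewrite eqseq_cat ?size_map ?sp // => /andP[/eqP-> /eqP->].
by [].
Qed.

End BenderKnuth.
End Descents.

Section BenderKnuthCount.
Variables (n : nat) (a b : 'I_n).
Hypothesis ab : a = b.+1 :> nat.
Implicit Types (k : 'I_n -> nat) (w : seq 'I_n) (J : seq nat).

Definition swapk k := fun l => k (tperm a b l).

Lemma swapkK k : swapk (swapk k) =1 k.
Proof. by move=> l; rewrite /swapk tpermK. Qed.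

Definition joined J w := has (junction a b w) J.

Definition allowed J w := noncrossing w && all (descent_at w) J.

(** The position of the junction together with the merged word identifies a
word on both sides, and [joined_ex] shows that every such pair that occurs for
[k] occurs for the exchanged multiplicities. *)
Lemma joined_le J k :
  (size [seq w <- words k | allowed J w && joined J w]
     <= size [seq w <- words (swapk k) | allowed J w && joined J w])%N.
Proof.
(* The junction is recorded by its rank in [J]. *)
pose h w := (find (junction a b w) J, map (merge_ab a b) w).
rewrite -(size_map h) -[leqRHS](size_map h).
have firstP w : joined J w ->
    [/\ find (junction a b w) J < size J,
        nth 0 J (find (junction a b w) J) \in J &
        junction a b w (nth 0 J (find (junction a b w) J))]%N.
  move=> Jw; have fJ := Jw; rewrite /joined has_find in fJ.
  by rewrite mem_nth // nth_find.
apply: uniq_leq_size => [|_ /mapP[w + ->]].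
  rewrite map_inj_in_uniq ?filter_uniq ?words_uniq // => w1 w2.
  rewrite !mem_filter => /andP[/andP[/andP[nc1 _] J1] k1].
  move=> /andP[/andP[/andP[nc2 _] J2] k2] [Ef Em].
  have [_ _ j1] := firstP _ J1; have [_ _ j2] := firstP _ J2.
  by rewrite -Ef in j2; apply: (joined_inj ab k1 k2 nc1 nc2 j1 j2 Em).
rewrite mem_filter => /andP[/andP[/andP[nc good] Jw] kw].
have [_ jJ jw] := firstP _ Jw.
have [v [kv ncv jv Em]] := joined_ex ab kw nc jw.
have jE i : junction a b w i = junction a b v i.
  apply/idP/idP => ji.
    by rewrite (junction_uniq ab nc ji jw).
  by rewrite (junction_uniq ab ncv ji jv).
have JE : find (junction a b v) J = find (junction a b w) J.
  by apply: eq_find => i; rewrite jE.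
apply/mapP; exists v; last by rewrite /h JE Em.
rewrite mem_filter kv andbT /allowed ncv /=; apply/andP; split.
  apply/allP => i iJ; have iw := allP good i iJ.
  exact: (descent_at_merge ab (esym Em) iw (jE i)).
by apply/hasP; exists (nth 0%N J (find (junction a b w) J)).
Qed.

Lemma noncrossing_map (T : finType) (f : T -> T) (s : seq T) :
  injective f -> noncrossing s -> noncrossing (map f s).
Proof.
move=> inj /noncrossingP nc; apply/noncrossingP => y z yz; apply/negP.
case/subseqP=> m _; rewrite -map_mask.
case Em : (mask m s) => [|t1 [|t2 [|t3 [|t4 [|]]]]] //= [y1 z2 y3 z4].
have e3 : t3 = t1 by apply: inj; rewrite -y1.
have e4 : t4 = t2 by apply: inj; rewrite -z2.
have t12 : t1 != t2 by rewrite -(inj_eq inj) -y1 -z2.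
by case/negP: (nc _ _ t12); move: (mask_subseq m s); rewrite Em e3 e4.
Qed.

(** Without the factor [ab] at a position of [J], exchanging the two letters
everywhere keeps the descents at [J]; it may create [ab] only where [ba] was,
which is not a descent. *)
Lemma unjoined_le J k :
  (size [seq w <- words k | allowed J w && ~~ joined J w]
     <= size [seq w <- words (swapk k) | allowed J w && ~~ joined J w])%N.
Proof.
have inj := inj_map (@perm_inj _ (tperm a b)).
rewrite -(size_map (map (tperm a b))); apply: uniq_leq_size.
  by rewrite map_inj_uniq ?filter_uniq ?words_uniq.
move=> _ /mapP[w + ->]; rewrite !mem_filter.
move=> /andP[/andP[/andP[nc good] nJ] /wordsP kw].
have vE (p q : 'I_n) : p = q -> p = q :> nat by move=> ->.
apply/andP; split; last first.
  apply/wordsP => l; rewrite count_map /swapk -kw; apply: eq_count => x /=.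
  by rewrite (can2_eq (tpermK a b) (tpermK a b)).
have descJ i : i \in J -> [&& (i.+1 < size w)%N,
    (tperm a b (nth a w i.+1) < tperm a b (nth a w i))%N &
    ~~ junction a b (map (tperm a b) w) i].
  move=> iJ; have := allP good i iJ; rewrite (descent_at_nth a) => /andP[iw desc].
  have : ~~ junction a b w i by apply: contra nJ => ji; apply/hasP; exists i.
  have iw' := ltnW iw; rewrite /junction size_map iw !(nth_map a) //=.
  move: (nth a w i) (nth a w i.+1) desc => x y.
  have vN (p q : 'I_n) : p <> q -> p <> q :> nat by move=> pq /val_inj.
  have := ab; rewrite -!(inj_eq val_inj) /=.
  case: tpermP => [/vE ?|/vE ?|/vN ? /vN ?];
    case: tpermP => [/vE ?|/vE ?|/vN ? /vN ?]; lia.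
apply/andP; split; last first.
  by apply/hasPn => i /descJ /and3P[].
rewrite /allowed noncrossing_map //=; last exact: perm_inj.
apply/allP => i /descJ/and3P[iw desc _].
by rewrite (descent_at_nth a) size_map iw !(nth_map a) // ltnW.
Qed.

(** Exchanging the multiplicities twice gives back the content, so the
inequality, valid for all contents, is an equality. *)
Lemma allowed_count J k :
  count (allowed J) (words k) = count (allowed J) (words (swapk k)).
Proof.
have split_count k' : count (allowed J) (words k') =
    (size [seq w <- words k' | allowed J w && joined J w] +
     size [seq w <- words k' | allowed J w && ~~ joined J w])%N.
  rewrite -size_filter -(count_predC (joined J)) !count_filter !size_filter.
  by congr addn; apply: eq_count => w /=; rewrite andbC.
have le k' : (count (allowed J) (words k') <= count (allowed J) (words (swapk k')))%N.
  by rewrite !split_count leq_add ?joined_le ?unjoined_le.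
by apply/eqP; rewrite eqn_leq le /=; have := le (swapk k);
    rewrite (eq_words (swapkK k)).
Qed.

Lemma sum_swapk k : (\sum_l swapk k l = \sum_l k l)%N.
Proof. by rewrite [RHS](reindex_inj (@perm_inj _ (tperm a b))). Qed.

Definition descset N w : {set 'I_N} := [set i : 'I_N | descent_at w i].

(** From descent sets that contain [D] to descent sets equal to [D]: subtract
the strict supersets, by induction on the size of the complement. *)
Lemma descset_count k (D : {set 'I_(\sum_l k l)}) :
  count (fun w => noncrossing w && (descset _ w == D)) (words k)
  = count (fun w => noncrossing w && (descset _ w == D)) (words (swapk k)).
Proof.
have [m] := ubnP #|~: D|; elim: m D => // m IH D ltDm.
(* Descending at every element of [D] means having a descent set above [D]. *)
have supE k' : count (allowed (map val (enum D))) (words k') =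
    (\sum_(D' : {set 'I_(\sum_l k l)} | D \subset D')
       count (fun w => noncrossing w && (descset _ w == D')) (words k'))%N.
  rewrite -sum1_count (partition_big (descset (\sum_l k l)) (fun D' =>
      D \subset D')) /=.
    apply: eq_bigr => D' DD'; rewrite -sum1_count; apply: eq_bigl => w.
    rewrite /allowed -andbA; case: (noncrossing w) => //=.
    have [E|] := eqVneq; rewrite ?andbF // andbT; apply/allP => _ /mapP[i + ->].
    by rewrite mem_enum => /(subsetP DD'); rewrite -E inE.
  move=> w /andP[_ /allP good]; apply/subsetP => i iD; rewrite inE; apply: good.
  by apply/mapP; exists i; rewrite // mem_enum.
have := allowed_count (map val (enum D)) k; rewrite !supE.
rewrite (bigD1 D) //= [in RHS](bigD1 D) //= => /eqP.
rewrite (eq_bigr (fun D' => count (fun w =>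
    noncrossing w && (descset _ w == D')) (words (swapk k)))).
  by rewrite eqn_add2r => /eqP.
move=> D' /andP[DD' neD]; apply: IH; apply: (@leq_trans #|~: D|) => //.
apply: proper_card; rewrite properEneq setCS DD' andbT.
by apply: contra neD => /eqP/setC_inj ->.
Qed.

(** Both sides are the same combination of the counts in [descset_count]: only
the descent set matters, not which words have it. *)
Lemma noncrossing_sum_swap (R : nmodType) k (G : seq 'I_n -> R) :
  (forall w w', size w = size w' -> descent_at w =1 descent_at w' -> G w = G w') ->
  \sum_(w <- words k | noncrossing w) G w
  = \sum_(w <- words (swapk k) | noncrossing w) G w.
Proof.
move=> Gdesc; set N := (\sum_l k l)%N.
(* [F D] is the value of [G] at some word with descent set [D], if there is one. *)
pose F (D : {set 'I_N}) :=
  G (head [::] [seq w <- words k ++ words (swapk k) | descset N w == D]).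
have GF w : w \in words k ++ words (swapk k) -> G w = F (descset N w).
  have szN u : u \in words k ++ words (swapk k) -> size u = N.
    by rewrite mem_cat => /orP[]/words_size; rewrite ?sum_swapk.
  move=> kw; rewrite /F; set s := filter _ _.
  have : w \in s by rewrite mem_filter eqxx.
  have : head [::] s \in s -> G w = G (head [::] s).
    rewrite mem_filter => /andP[/eqP/setP E ku]; apply: Gdesc; rewrite ?szN // => i.
    have [iN|iN] := ltnP i N; first by have := E (Ordinal iN); rewrite !inE.
    by rewrite /descent_at !szN //= ltnNge ltnW ?ltnS.
  by case: (s) => // u s' /(_ (mem_head _ _)) ->.
have sumE k' : {subset words k' <= words k ++ words (swapk k)} ->
    \sum_(w <- words k' | noncrossing w) G w =
    \sum_D F D *+ count (fun w => noncrossing w && (descset N w == D)) (words k').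
  move=> sub; rewrite big_seq_cond.
  rewrite (eq_bigr (fun w => F (descset N w))) => [|w /andP[/sub/GF]//].
  rewrite -big_seq_cond (partition_big (descset N) xpredT) //.
  apply: eq_bigr => D _.
  rewrite (eq_bigr (fun=> F D)) => [|w /andP[_ /eqP->]//].
  by rewrite big_const_seq iter_addr_0.
rewrite !sumE => [|w|w]; try by rewrite mem_cat => ->; rewrite ?orbT.
by apply: eq_bigr => D _; rewrite descset_count.
Qed.

End BenderKnuthCount.

(** * Weights and decreasing runs *)

Section Weights.
Variable n : nat.
Implicit Types (w u v : seq 'I_n) (x y : 'I_n).

Definition decr : rel 'I_n := fun x y => (y < x)%N.

Lemma consec_desc_cons s x w : (0 < s)%N ->
  consec_desc s (x :: w) =
  ((s <= (size w).+1)%N && sorted decr (take s (x :: w)) + consec_desc s w)%N.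
Proof.
move=> s_gt0; rewrite /consec_desc /=; case: leqP => [le_s|lt_s]; last first.
  by rewrite big_geq ?big_geq // leqn0 subn_eq0 // ltnW.
rewrite subSn // big_nat_recl // drop0 /=; congr addn.
Qed.

Lemma desc_weight_descents w w' :
  size w = size w' -> descent_at w =1 descent_at w' -> desc_weight w = desc_weight w'.
Proof.
move=> sw dw; apply: eq_bigr => s _; congr (_ ^+ _).
rewrite /consec_desc -sw; apply: eq_big_nat => j /andP[_ ltj]; congr nat_of_bool.
have half u u' : size u = size w -> size u = size u' -> descent_at u =1 descent_at u' ->
    sorted decr (take s (drop j u)) -> sorted decr (take s (drop j u')).
  move=> szw su du; case: u szw su du => [|x0 u szw su du].
    by case: u' => // _ _ _; rewrite /= !take_nil.
  have szj : (s <= size (x0 :: u) - j)%N by rewrite szw; lia.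
  move=> /(sortedP x0) srt; apply/(sortedP x0) => i; move: (srt i).
  rewrite !size_takel ?size_drop -?su // => srti lt_is.
  have lt_iu : (j + i.+1 < size (x0 :: u))%N by lia.
  rewrite addnS in lt_iu; have := srti lt_is.
  rewrite !nth_take ?(ltnW lt_is) // !nth_drop /decr !addnS.
  have := du (j + i)%N; rewrite !(descent_at_nth x0) -su lt_iu /=.
  by move=> ->.
by apply/idP/idP; apply: half.
Qed.

(** A decreasing factor cannot cross a position that is not a descent. *)
Lemma desc_weight_cat u x v : ~~ (head x v < x)%N ->
  desc_weight (rcons u x ++ v) = desc_weight (rcons u x) * desc_weight v.
Proof.
move=> xv; rewrite -big_split /=; apply: eq_big_nat => s /andP[s_gt0 _].
rewrite -exprD; congr (_ ^+ _).
elim: u => [|y u IH] /=.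
  rewrite !consec_desc_cons // {2}/consec_desc big_geq ?addn0;
      last by rewrite leq_subLR addn0.
  congr addn; case: s s_gt0 => // -[|s] _ /=; first by rewrite !take0.
  by case: v xv => //= y v xv; rewrite /decr (negPf xv) andbF.
rewrite !consec_desc_cons // IH addnA; congr (_ + _ + _)%N.
rewrite size_cat.
have [le_s|lt_s] := leqP s (size (rcons u x)).+1.
  by rewrite -!cat_cons takel_cat //= (leq_trans le_s) // ltnS leq_addr.
rewrite (_ : take s _ = (y :: rcons u x) ++ take (s - (size (rcons u x)).+1) v).
  2: by rewrite -cat_cons take_cat /= ltnNge (ltnW lt_s).
case: andP => // -[le_s].
case: v xv le_s {IH} => [|z v] xv le_s; first by rewrite /= addn0 in le_s; lia.
have -> : (s - (size (rcons u x)).+1 = (s - (size (rcons u x)).+2).+1)%N by lia.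
by rewrite /= cat_path last_rcons /= /decr (negPf xv) andbF.
Qed.

Definition run_weight r : tpoly := \prod_(1 <= i < r.+1) tvar i ^+ (r.+1 - i).

Lemma sorted_decr_uniq w : sorted decr w -> uniq w.
Proof.
apply: sorted_uniq => [y x z|x]; rewrite /decr ?ltnn //.
by move=> yx zy; apply: ltn_trans yx.
Qed.

Lemma desc_weight_sorted w : sorted decr w -> desc_weight w = run_weight (size w).
Proof.
move=> srt.
have le_wn : (size w <= n)%N.
  by rewrite -(card_uniqP (sorted_decr_uniq srt)) -[leqRHS]card_ord max_card.
rewrite /desc_weight /run_weight (big_cat_nat _ (n := (size w).+1)) //=.
rewrite [X in _ * X]big1_seq ?mulr1; last first.
  move=> s /andP[_]; rewrite mem_index_iota => /andP[lt_ws _].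
  by rewrite /consec_desc big_geq // leqn0 subn_eq0.
apply: eq_big_nat => s /andP[s_gt0 le_s]; congr (_ ^+ _).
rewrite /consec_desc (eq_bigr (fun=> 1%N)) ?sum_nat_const_nat ?subn0 ?muln1 //.
by move=> j _; rewrite take_sorted ?drop_sorted.
Qed.

Lemma desc_weight_nil : desc_weight ([::] : seq 'I_n) = 1.
Proof. by rewrite desc_weight_sorted // /run_weight big_geq. Qed.

Lemma coef_Tseries m : fps_coef (1 + Tseries) m = run_weight m.
Proof.
by case: m => [|m] /=; rewrite ?addr0 ?add0r // /run_weight big_geq.
Qed.

(** The coefficient of [z^r] in [(1 - W) (1 + T) = 1]. *)
Lemma run_weight_rec r : (0 < r)%N ->
  run_weight r = \sum_(1 <= m < r.+1) Wbar m * run_weight (r - m).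
Proof.
case: r => // r _.
have U : 1 + Tseries \is a GRing.unit.
  by apply/fps_unitP; exists 1; rewrite /= addr0 mulr1.
have := mulVr U => /(congr1 (@fps_coef _ ^~ r.+1)) /=.
rewrite big_ord_recl /= subn0.
have -> : fps_coef (1 + Tseries)^-1 0 = 1.
  have := mulVr U => /(congr1 (@fps_coef _ ^~ 0%N)) /=.
  by rewrite big_ord1 /= addr0 mulr1.
rewrite mul1r add0r => /eqP; rewrite addr_eq0 => /eqP.
rewrite {1}/run_weight => ->; rewrite big_add1 /= big_mkord -sumrN.
apply: eq_bigr => i _; rewrite -coef_Tseries mulNr.
by rewrite /= /bump /= add1n.
Qed.


Lemma decr_cat u x v : sorted decr (rcons u x ++ v) =
  [&& sorted decr (rcons u x), (v == [::]) || (head x v < x)%N & sorted decr v].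
Proof.
case: v => [|z v]; first by rewrite cats0 !andbT.
case: u => [|y u] /=; first by [].
by rewrite cat_path last_rcons.
Qed.

Lemma first_run w : w != [::] -> exists u x v,
  [/\ w = rcons u x ++ v, sorted decr (rcons u x) & ~~ (head x v < x)%N].
Proof.
elim: w => // y w IH _; case: w IH => [|z w] IH.
  by exists [::], y, [::]; split; rewrite //= ltnn.
have [lt_zy|le_yz] := ltnP z y; last first.
  by exists [::], y, (z :: w); split; rewrite //= ltnNge le_yz.
have [//|u [x [v [wE srt tail]]]] := IH.
exists (y :: u), x, v; split=> //; first by rewrite wE.
by case: u wE srt => [|z' u] /= [<- _] srt; rewrite ?srt /decr lt_zy.
Qed.

(** The decreasing prefixes of [w] are the prefixes of its first run; removing
one of size [m] from a run of size [r] leaves a run of size [r - m], so that the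
identity is [run_weight_rec] times the weight of what follows the run. *)
Lemma desc_weight_rec w : w != [::] ->
  desc_weight w =
  \sum_(1 <= m < (size w).+1 | sorted decr (take m w))
     Wbar m * desc_weight (drop m w).
Proof.
move=> /first_run[u [x [v [-> srt tail]]]].
set r := size (rcons u x).
have r_gt0 : (0 < r)%N by rewrite /r size_rcons.
rewrite desc_weight_cat // desc_weight_sorted // run_weight_rec // mulr_suml.
rewrite [RHS]big_mkcond (big_cat_nat _ (n := r.+1)) //=; last first.
  by rewrite ltnS size_cat leq_addr.
rewrite [X in _ + X]big1_seq ?addr0; last first.
  move=> m /andP[_]; rewrite mem_index_iota size_cat => /andP[lt_rm lt_m].
  rewrite take_cat -/r ltnNge ltnW //= decr_cat srt /=.
  case: v tail lt_m => [|z v] tail lt_m; first by move: lt_m;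
      rewrite addn0 ltnS leqNgt lt_rm.
  by rewrite -(subnSK lt_rm) /= (negPf tail).
apply: eq_big_nat => m /andP[m_gt0 le_mr].
rewrite takel_cat // (subseq_sorted _ (take_subseq _ _) srt); last first.
  by move=> p q s pq qs; apply: ltn_trans qs pq.
rewrite -mulrA; congr (_ * _).
rewrite drop_cat -/r; case: ltnP => [lt_mr|le_rm]; last first.
  have -> : m = r by apply: anti_leq; rewrite -ltnS le_mr.
  by rewrite subnn drop0 /run_weight big_geq // mul1r.
have le_mu : (m <= size u)%N by move: lt_mr; rewrite /r size_rcons ltnS.
have -> : (r - m)%N = size (rcons (drop m u) x).
  by rewrite /r !size_rcons size_drop subSn.
have dE : drop m (rcons u x) = rcons (drop m u) x by rewrite (drop_rcons le_mu x).
rewrite dE (desc_weight_cat _ tail); congr (_ * _); symmetry.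
apply: desc_weight_sorted; rewrite -dE.
apply: (subseq_sorted _ (drop_subseq _ _) srt).
by move=> p q s pq qs; apply: ltn_trans qs pq.
Qed.

End Weights.

(** * Splitting off a factor at the smallest letter *)

Section Peel.
Variables (n : nat) (x : 'I_n).
Implicit Types (w u v t r : seq 'I_n) (k : 'I_n -> nat).

Definition cut w := (take (index x w) w, drop (index x w).+1 w).

Lemma cut_cat u v : x \notin u -> cut (u ++ x :: v) = (u, v).
Proof.
move=> xu; rewrite /cut index_cat (negPf xu) /= eqxx addn0.
by rewrite take_size_cat // -cat_rcons drop_size_cat // size_rcons.
Qed.

Lemma cutE w : x \in w -> exists u v, w = u ++ x :: v /\ x \notin u.
Proof.
elim: w => // y w IH; rewrite inE; case: eqVneq => [-> _|xy /= /IH[u [v [-> xu]]]].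
  by exists [::], w.
by exists (y :: u), v; split=> //; rewrite inE negb_or xy.
Qed.

(** A word [u0 x u1 x r] gives the factor [u1] and the word [u0 x r] that is left.
If [r] is empty, it gives [u0] and [u1 x] instead: a letter following the word
may continue the run that ends with the last [x], and this run has to stay in
the second component. *)
Definition peel w :=
  let: (u0, w1) := cut w in let: (u1, r) := cut w1 in
  if r == [::] then (u0, rcons u1 x) else (u1, u0 ++ x :: r).

Definition unpeel uv :=
  let: (u, v) := uv in let: (v0, r) := cut v in
  if r == [::] then u ++ x :: v else v0 ++ x :: u ++ x :: r.

(** The letters of the factor occur nowhere else, since one of them on the other
side of an [x] would cross with [x].  As no letter is smaller than [x], a run
ends after the factor and its [x], and the weight splits there. *)
Lemma peel_spec w : (1 < count_mem x w)%N -> noncrossing w ->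
  let: (u, v) := peel w in
  [/\ x \notin u, noncrossing u, noncrossing v, {in u, forall y, y \notin v} &
      [/\ unpeel (u, v) = w,
      forall l, count_mem l w = (count_mem l u + count_mem l v + (x == l))%N &
      (forall y, y \in w -> (x <= y)%N) -> forall t,
        desc_weight (w ++ t) = desc_weight (rcons u x) * desc_weight (v ++ t)]].
Proof.
move=> cw nc.
have /cutE[u0 [w1 [E xu0]]] : x \in w by rewrite -has_pred1 has_count ltnW.
have /cutE[u1 [r [E1 xu1]]] : x \in w1.
  move: cw; rewrite E count_cat (count_memPn xu0) /= eqxx add0n add1n ltnS.
  by rewrite -has_count has_pred1.
subst w1; rewrite /peel E cut_cat // cut_cat // -E.
have ncw : forall y z, y != z -> ~~ subseq [:: y; z; y; z] (u0 ++ x :: u1 ++ x :: r).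
  by apply/noncrossingP; rewrite -E.
have disj1 y : y \in u1 -> y \notin u0 ++ x :: r.
  move=> yu1; have yx : y != x by apply: contraNneq xu1 => <-.
  rewrite mem_cat inE (negPf yx) /= negb_or; apply/andP; split.
    apply/negP => yu0; case/negP: (ncw y x yx).
    by rewrite (@cat_subseq _ [:: y] [:: x; y; x]) ?sub1seq //= eqxx
       (@cat_subseq _ [:: y] [:: x]) ?sub1seq // mem_head.
  apply/negP => yr; rewrite eq_sym in yx; case/negP: (ncw x y yx).
  apply: (@cat_subseq _ [::] [:: x; y; x; y]); rewrite ?sub0seq //= eqxx.
  by rewrite (@cat_subseq _ [:: y] [:: x; y]) ?sub1seq //= eqxx sub1seq.
have disj0 y : y \in u0 -> y \notin u1.
  by move=> yu0; apply/negP => /disj1; rewrite mem_cat yu0.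
have nc0 : noncrossing u0 by apply: noncrossing_subseq nc; rewrite E prefix_subseq.
have nc1 : noncrossing u1.
  apply: noncrossing_subseq nc; rewrite E -cat_rcons.
  by apply: subseq_trans (suffix_subseq _ _); apply: prefix_subseq.
have [r0|r0] := eqVneq r [::].
  subst r; split=> //.
  - apply: noncrossing_subseq nc; rewrite E -cat_rcons cats1; exact: suffix_subseq.
  - move=> y yu0; rewrite mem_rcons inE negb_or disj0 // andbT.
    by apply: contraNneq xu0 => <-.
  split.
  - by rewrite /unpeel -cats1 cut_cat.
  - by move=> l; rewrite E !count_cat -cats1 /= !count_cat /=; lia.
  - move=> ge t; rewrite E -cat_rcons cats1 -catA desc_weight_cat //.
    case: u1 {disj1 disj0 xu1 nc1 ncw} E ge => [|y u1] E ge /=; first by rewrite ltnn.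
    by rewrite -leqNgt; apply: ge; rewrite E mem_cat !inE eqxx !orbT.
split=> //.
- apply: noncrossing_subseq nc; rewrite E cat_subseq //= eqxx.
  by apply: subseq_trans (suffix_subseq _ _); apply: subseq_cons.
split.
- by rewrite /unpeel cut_cat // (negPf r0).
- by move=> l; rewrite E !count_cat /= !count_cat /=; lia.
move=> ge t.
case: r r0 E {ncw disj1} => // y r _ E.
have sub3 z s : z \in y :: r -> ~~ (head x (z :: s) < x)%N.
  by move=> zr; rewrite -leqNgt; apply: ge; rewrite E !(mem_cat, inE) -in_cons zr !orbT.
have -> : w ++ t = rcons u0 x ++ (rcons u1 x ++ ((y :: r) ++ t)).
  by rewrite E !cat_rcons -!catA /= -!catA.
have -> : (u0 ++ x :: y :: r) ++ t = rcons u0 x ++ ((y :: r) ++ t).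
  by rewrite cat_rcons -catA.
have sub1 : ~~ (head x (rcons u1 x ++ (y :: r) ++ t) < x)%N.
  case: u1 E {disj0 xu1 nc1} => [|z u1] E; first by rewrite /= ltnn.
  by rewrite /= -leqNgt; apply: ge; rewrite E !(mem_cat, inE) eqxx !orbT.
have sub2 := sub3 y (r ++ t) (mem_head _ _).
rewrite (desc_weight_cat _ sub1) !(desc_weight_cat _ sub2).
by rewrite mulrCA.
Qed.

(** Inserting is doubling the letter [x], up to a rotation if nothing follows it,
and then inserting a word on other letters between the two copies. *)
Lemma unpeel_spec u v : x \notin u -> x \in v -> noncrossing u ->
  noncrossing v -> {in u, forall y, y \notin v} ->
  [/\ noncrossing (unpeel (u, v)), peel (unpeel (u, v)) = (u, v) &
      forall l, count_mem l (unpeel (u, v)) =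
                (count_mem l u + count_mem l v + (x == l))%N].
Proof.
move=> xu /cutE[v0 [r [-> xv0]]] ncu ncv dj; rewrite /unpeel cut_cat //.
have [r0|r0] := eqVneq r [::].
  subst r; rewrite /peel cut_cat // cut_cat //=; split.
  - have nc1 : noncrossing (x :: v0 ++ [:: x]).
      apply: (noncrossing_rot (u := v0 ++ [:: x]) (v := [:: x])).
      by rewrite -catA; apply: noncrossing_double.
    apply: (noncrossing_insert (v1 := [::])) => // y yu /=.
    by rewrite inE negb_or dj // andbT; apply: contraNneq xu => <-.
  - by rewrite cats1.
  - by move=> l; rewrite !count_cat /= !count_cat /=; lia.
rewrite /peel cut_cat // cut_cat // (negPf r0); split=> //.
- rewrite -cat_rcons; apply: noncrossing_insert => //.
    move=> y yu; rewrite cat_rcons !(mem_cat, inE).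
    by have := dj y yu; rewrite !(mem_cat, inE); case: (y == x).
  by rewrite cat_rcons; apply: noncrossing_double.
- by move=> l; rewrite !count_cat /= !count_cat /=; lia.
Qed.

(** The suffix [t] will be empty, or one letter smaller than the letters of the
words: its purpose is to lengthen the last run. *)
Definition noncrossing_sum t k : tpoly :=
  \sum_(w <- words k | noncrossing w) desc_weight (w ++ t).

Definition restrict_content (S : {set 'I_n}) k := fun l => if l \in S then k l else 0%N.
Definition remaining_content (S : {set 'I_n}) k :=
  fun l => if l \in S then 0%N else (k l - (x == l))%N.

(** [S] is the set of letters of the factor that is split off. *)
Lemma noncrossing_sum_peel t k : (forall y : 'I_n, (y < x)%N -> k y = 0%N) ->
    (1 < k x)%N ->
  noncrossing_sum t k =
  \sum_(S : {set 'I_n} | S \subset [set y | (0 < k y)%N && (y != x)])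
     noncrossing_sum [:: x] (restrict_content S k) *
         noncrossing_sum t (remaining_content S k).
Proof.
move=> kmin kx; rewrite /noncrossing_sum.
pose A := [set y | (0 < k y)%N && (y != x)].
pose Pk w := (w \in words k) && noncrossing w.
have peelA w : Pk w -> [set y in (peel w).1] \subset A.
  move=> /andP[/wordsP kw nc]; have := peel_spec (w := w); rewrite kw => /(_ kx nc).
  case: (peel w) => u v [xu _ _ _ [_ cnt _]] /=; apply/subsetP => y; rewrite !inE => yu.
  rewrite (contraNneq _ xu) ?andbT => [|<-//].
  by rewrite -kw cnt -addnA addn_gt0 -has_count has_pred1 yu.
rewrite big_seq_cond -/Pk (eq_bigl Pk) //.
rewrite (partition_big (fun w => [set y in (peel w).1]) (fun S => S \subset A) peelA).
apply: eq_bigr => S SA; rewrite big_distrlr /=.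
rewrite (eq_bigl (fun w => [&& w \in words k & noncrossing w && ([set y in (peel w).1]
    == S)])).
  2: by move=> w; rewrite /Pk -andbA.
rewrite -big_seq_cond -[LHS]big_filter -[RHS]big_filter.
under [RHS]eq_bigr do rewrite -big_filter.
rewrite -(big_allpairs (F := fun uv => desc_weight (uv.1 ++ [:: x]) *
    desc_weight (uv.2 ++ t))).
have xS : x \notin S by apply/negP => /(subsetP SA); rewrite !inE eqxx andbF.
apply: (big_seq_bij (f := peel) (g := unpeel)).
- by rewrite filter_uniq ?words_uniq.
- apply: allpairs_uniq; rewrite ?filter_uniq ?words_uniq //.
  by move=> [? ?] [? ?] _ _ /= [-> ->].
- move=> w; rewrite mem_filter => /andP[/andP[nc /eqP]].
  move=> + kw'; have /wordsP kw := kw'.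
  have := peel_spec (w := w); rewrite kw => /(_ kx nc).
  case E : (peel w) => [u v] [xu ncu ncv dj [uvw cnt wt]] /= defS.
  have inS l : (l \in S) = (l \in u) by rewrite -defS inE.
  split; [|by []|]; last first.
    rewrite cats1; apply: wt => y yw; rewrite leqNgt; apply/negP => /kmin ky.
    by move: yw; rewrite (mem_words _ kw') ky.
  apply: allpairs_f; rewrite mem_filter ?ncu ?ncv; apply/wordsP => l.
    rewrite /restrict_content inS; case: ifPn => [lu|/count_memPn//].
    rewrite -kw cnt (count_memPn (dj _ lu)) addn0.
    by case: eqP lu => [<-|_ _]; rewrite ?(negPf xu) ?addn0.
  rewrite /remaining_content inS; case: ifPn => [/dj/count_memPn//|/count_memPn lu].
  by rewrite -kw cnt lu addnK.
move=> _ /allpairsP[[u v] [/= + + ->]]; rewrite !mem_filter.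
move=> /andP[ncu ku'] /andP[ncv kv'].
have /wordsP ku := ku'; have /wordsP kv := kv'.
have inu l : (l \in u) = (l \in S).
  rewrite (mem_words _ ku') /restrict_content; case: ifP => // lS.
  by have := subsetP SA l lS; rewrite inE => /andP[].
have xu : x \notin u by rewrite inu.
have xv : x \in v by rewrite (mem_words _ kv') /remaining_content (negPf xS) eqxx
    subn_gt0.
have dj : {in u, forall y, y \notin v}.
  by move=> y; rewrite inu (mem_words _ kv') /remaining_content => ->.
have [nc pu cnt] := unpeel_spec xu xv ncu ncv dj.
split=> //; rewrite nc pu /=; apply/andP; split.
  by apply/eqP/setP => l; rewrite inE inu.
apply/wordsP => l; rewrite cnt ku kv /restrict_content /remaining_content;
    case: ifP => lS.
  by case: eqP lS => [<-|_ _]; rewrite ?(negPf xS) ?addn0.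
by rewrite add0n subnK //; case: eqP => // <-; apply: ltnW.
Qed.

End Peel.

(** * Transferring copies between the two smallest letters *)

Section Convolution.
Variables (T : finType) (R : comPzRingType).
Implicit Types (f g h : {set T} -> R) (B S U : {set T}).

(** The product of exponential generating functions, for functions that depend
on the set of letters and not only on its size. *)
Definition conv f g B := \sum_(S : {set T} | S \subset B) f S * g (B :\: S).

Lemma eq_conv f1 f2 g1 g2 B :
  (forall S, S \subset B -> f1 S = f2 S) -> (forall S, S \subset B -> g1 S = g2 S) ->
  conv f1 g1 B = conv f2 g2 B.
Proof. by move=> ef eg; apply: eq_bigr => S SB; rewrite ef ?eg ?subsetDl. Qed.

Lemma convC f g : conv f g =1 conv g f.
Proof.
move=> B; rewrite /conv (reindex_onto (setD B) (setD B)) /=.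
  apply: eq_big => [S|S /andP[_ /eqP->]]; last by rewrite mulrC.
  by rewrite subsetDl setDDr setDv set0U /=; apply/eqP/setIidPr.
by move=> S SB; rewrite setDDr setDv set0U; apply/setIidPr.
Qed.

Lemma convA f g h : conv f (conv g h) =1 conv (conv f g) h.
Proof.
move=> B; rewrite /conv.
under eq_bigr do rewrite mulr_sumr.
under [RHS]eq_bigr do rewrite mulr_suml.
rewrite [RHS](exchange_big_dep (fun S => S \subset B)) /=; last first.
  by move=> S U SB US; apply: subset_trans SB.
apply: eq_bigr => S SB.
rewrite [RHS](reindex_onto (fun U => S :|: U) (fun U => U :\: S)) /=.
  rewrite [RHS](eq_bigl (fun U => U \subset B :\: S)) => [|U].
    apply: eq_bigr => U; rewrite subsetD => /andP[_ dUS].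
    rewrite setDDl mulrA; congr (_ * g _ * _).
    by rewrite setDUl setDv set0U; apply/esym/setDidPl.
  rewrite subsetUl subUset SB subsetD !andbT; congr andb.
  by rewrite setDUl setDv set0U; apply/eqP/setDidPl.
move=> U /andP[_ SU]; apply/setP => x; rewrite !inE.
by case: (boolP (x \in S)) => // /(subsetP SU) ->.
Qed.

Lemma sum_subsetU1 (a : T) B (F : {set T} -> R) : a \notin B ->
  \sum_(S : {set T} | S \subset a |: B) F S =
  \sum_(S : {set T} | S \subset B) (F S + F (a |: S)).
Proof.
move=> aB; rewrite big_split /= (bigID (fun S : {set T} => a \notin S)) /=;
    congr (_ + _).
  apply: eq_bigl => S; rewrite -subsetD1 setU1K //.
rewrite (reindex_onto (fun S => a |: S) (fun S => S :\ a)) /=.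
  apply: eq_bigl => S; rewrite negbK setU11 andbT.
  apply/andP/idP => [[sub /eqP E]|SB].
    by rewrite -E subDset.
  rewrite setUS // setU1K //; apply: contra aB; exact: (subsetP SB).
by move=> S /andP[_]; rewrite negbK; apply: setD1K.
Qed.

End Convolution.

Lemma desc_weight_rcons_min n (w : seq 'I_n) (x y : 'I_n) :
  (forall z, z \in w -> (x < z)%N && (y < z)%N) ->
  desc_weight (w ++ [:: x]) = desc_weight (w ++ [:: y]).
Proof.
move=> wP; rewrite !cats1; apply: desc_weight_descents => [|i]; rewrite ?size_rcons //.
rewrite !(descent_at_nth x) !size_rcons !ltnS !nth_rcons.
case: (ltngtP i.+1 (size w)) => [lt_i|gt_i|eq_i]; rewrite ?andbF //.
by have /andP[-> ->] : (x < nth x w i)%N && (y < nth x w i)%N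
  by apply: wP; rewrite mem_nth // -eq_i.
Qed.

Lemma eq_noncrossing_sum n (t : seq 'I_n) (k1 k2 : 'I_n -> nat) : k1 =1 k2 ->
    noncrossing_sum t k1 = noncrossing_sum t k2.
Proof. by move=> /eq_words e; rewrite /noncrossing_sum e. Qed.

Section Transfer.
Variables (m : nat).
Let n := m.+2.
Let c : 'I_n := ord0.
Let a : 'I_n := lift ord0 ord0.
Variable k : 'I_n -> nat.
Hypothesis k_gt0 : forall l, (0 < k l)%N.
Implicit Types (B S : {set 'I_n}).

(** The content with [q] copies of the smallest letter [c], [p] copies of the
second smallest letter [a], and the fixed multiplicities [k] on [B]. *)
Definition content_with B p q (l : 'I_n) : nat :=
  if l == c then q else if l == a then p else if l \in B then k l else 0%N.

Definition plain_sum p q B := noncrossing_sum [::] (content_with B p q).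
Definition capped_sum p B := noncrossing_sum [:: c] (content_with B p 0).

Let ac : a = c.+1 :> nat. Proof. by []. Qed.
Let a_neq_c : a != c. Proof. by []. Qed.

Lemma plain_sum_sym p q B : plain_sum p q B = plain_sum q p B.
Proof.
rewrite /plain_sum /noncrossing_sum; rewrite (noncrossing_sum_swap ac).
  rewrite -/(noncrossing_sum [::] _) -/(noncrossing_sum [::] _);
      apply: eq_noncrossing_sum => l.
  rewrite /swapk /content_with; case: tpermP => [->|->|/eqP/negPf-> /eqP/negPf->//].
    by rewrite eqxx (negPf a_neq_c).
  by rewrite eqxx (negPf a_neq_c).
by move=> w w' sw dw; rewrite !cats0; apply: desc_weight_descents.
Qed.

Let D : {set 'I_n} := ~: [set c; a].

Let c_notin B : B \subset D -> c \notin B.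
Proof. by move=> BD; apply/negP => /(subsetP BD); rewrite !inE eqxx. Qed.

Let a_notin B : B \subset D -> a \notin B.
Proof. by move=> BD; apply/negP => /(subsetP BD); rewrite !inE eqxx orbT. Qed.

(** The copies of [a] lie all in the factor or all in the rest. *)
Lemma plain_sum_peel p q B : B \subset D ->
  plain_sum p.+1 q.+2 B =
  conv (capped_sum 0) (plain_sum p.+1 q.+1) B +
      conv (capped_sum p.+1) (plain_sum 0 q.+1) B.
Proof.
move=> BD; have [cB aB] := (c_notin BD, a_notin BD).
rewrite /plain_sum (@noncrossing_sum_peel _ c); [|by []|by []].
rewrite (_ : [set y | _] = a |: B); last first.
  apply/setP => l; rewrite !inE /content_with.
  have [->|_] := eqVneq l c; first by rewrite andbF (negPf cB) eq_sym (negPf a_neq_c).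
  by rewrite andbT; case: eqVneq => //= _; case: (l \in B); rewrite ?k_gt0.
rewrite (sum_subsetU1 _ aB) /conv -big_split.
apply: eq_bigr => S SB.
have aS : a \notin S by apply: contra aB; apply: (subsetP SB).
have cS : c \notin S by apply: contra cB; apply: (subsetP SB).
rewrite (@eq_noncrossing_sum _ _ (restrict_content S _) (content_with S 0 0)) => [|l];
    last first.
  rewrite /restrict_content /content_with; have [->|_] := eqVneq l c;
      first by rewrite (negPf cS).
  have [->|_] := eqVneq l a; first by rewrite (negPf aS).
  by case: ifP => // /(subsetP SB) ->.
rewrite (@eq_noncrossing_sum _ _ (remaining_content c S _) (content_with (B :\: S) p.+1
    q.+1)) => [|l]; last first.
  rewrite /remaining_content /content_with; have [->|_] := eqVneq l c;
      first by rewrite (negPf cS) subn1.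
  have [->|_] := eqVneq l a; first by rewrite (negPf aS).
  by rewrite subn0 inE; case: (l \in S).
rewrite (@eq_noncrossing_sum _ _ (restrict_content (a |: S) _) (content_with S p.+1 0))
    => [|l]; last first.
  rewrite /restrict_content /content_with !inE.
  have [->|_] := eqVneq l c; first by rewrite (negPf cS) eq_sym (negPf a_neq_c).
  have [->|_] := eqVneq l a; first by [].
  by rewrite /=; case: ifP => // /(subsetP SB) ->.
rewrite (@eq_noncrossing_sum _ _ (remaining_content c (a |: S) _) (content_with (B :\:
    S) 0 q.+1)) // => l.
rewrite /remaining_content /content_with !inE.
have [->|_] := eqVneq l c; first by rewrite (negPf cS) eq_sym (negPf a_neq_c) subn1.
have [->|_] := eqVneq l a; first by [].
by rewrite subn0 /=; case: (l \in S).
Qed.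

Lemma plain_sum0_peel q B : B \subset D ->
  plain_sum 0 q.+2 B = conv (capped_sum 0) (plain_sum 0 q.+1) B.
Proof.
move=> BD; have [cB aB] := (c_notin BD, a_notin BD).
rewrite /plain_sum (@noncrossing_sum_peel _ c); [|by []|by []].
rewrite (_ : [set y | _] = B); last first.
  apply/setP => l; rewrite !inE /content_with.
  have [->|_] := eqVneq l c; first by rewrite andbF (negPf cB).
  have [->|_] := eqVneq l a; first by rewrite (negPf aB).
  by rewrite andbT; case: (l \in B); rewrite ?k_gt0.
rewrite /conv; apply: eq_bigr => S SB.
have aS : a \notin S by apply: contra aB; apply: (subsetP SB).
have cS : c \notin S by apply: contra cB; apply: (subsetP SB).
rewrite (@eq_noncrossing_sum _ _ (restrict_content S _) (content_with S 0 0)) => [|l];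
    last first.
  rewrite /restrict_content /content_with; have [->|_] := eqVneq l c;
      first by rewrite (negPf cS).
  have [->|_] := eqVneq l a; first by rewrite (negPf aS).
  by case: ifP => // /(subsetP SB) ->.
rewrite (@eq_noncrossing_sum _ _ (remaining_content c S _) (content_with (B :\: S) 0
    q.+1)) // => l.
rewrite /remaining_content /content_with; have [->|_] := eqVneq l c;
    first by rewrite (negPf cS) subn1.
have [->|_] := eqVneq l a; first by rewrite (negPf aS).
by rewrite subn0 inE; case: (l \in S).
Qed.

(** Splitting at [a] the words that are followed by [c]; the factor ends with
[a] instead of [c], which makes no difference to letters larger than both. *)
Lemma capped_sum_peel p B : B \subset D ->
  capped_sum p.+2 B = conv (capped_sum 0) (capped_sum p.+1) B.
Proof.
move=> BD; have [cB aB] := (c_notin BD, a_notin BD).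
have kmin (y : 'I_n) : (y < a)%N -> content_with B p.+2 0 y = 0%N.
  move=> ya; have -> : y = c by apply: val_inj; apply/eqP; rewrite /= -leqn0 -ltnS.
  by rewrite /content_with eqxx.
rewrite /capped_sum (noncrossing_sum_peel _ kmin); last by [].
rewrite (_ : [set y | _] = B); last first.
  apply/setP => l; rewrite !inE /content_with.
  have [->|_] := eqVneq l c; first by rewrite (negPf cB).
  have [->|_] := eqVneq l a; first by rewrite (negPf aB).
  by rewrite andbT; case: (l \in B); rewrite ?k_gt0.
rewrite /conv; apply: eq_bigr => S SB.
have aS : a \notin S by apply: contra aB; apply: (subsetP SB).
have cS : c \notin S by apply: contra cB; apply: (subsetP SB).
rewrite (@eq_noncrossing_sum _ _ (restrict_content S _) (content_with S 0 0)) => [|l];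
    last first.
  rewrite /restrict_content /content_with; have [->|_] := eqVneq l c;
      first by rewrite (negPf cS).
  have [->|_] := eqVneq l a; first by rewrite (negPf aS).
  by case: ifP => // /(subsetP SB) ->.
rewrite (@eq_noncrossing_sum _ _ (remaining_content a S _) (content_with (B :\: S) p.+1
    0)) => [|l]; last first.
  rewrite /remaining_content /content_with; have [->|_] := eqVneq l c;
      first by rewrite (negPf cS).
  have [->|_] := eqVneq l a; first by rewrite (negPf aS) subn1.
  by rewrite subn0 inE; case: (l \in S).
suff -> : noncrossing_sum [:: a] (content_with S 0 0) =
    noncrossing_sum [:: c] (content_with S 0 0) by [].
rewrite /noncrossing_sum big_seq_cond [RHS]big_seq_cond;
    apply: eq_bigr => w /andP[kw _].
apply: desc_weight_rcons_min => z; rewrite (mem_words _ kw) /content_with.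
case: eqVneq => // zc; case: eqVneq => // za _.
have : (val z != val c) && (val z != val a) by rewrite !(inj_eq val_inj) zc.
by rewrite /=; case: (nat_of_ord z) => [|[|]].
Qed.

(** In the step from [q] to [q + 1], peeling [c] on both sides leaves two terms:
the first is the induction hypothesis, and in the second the additional copy, of
[a] on one side and of [c] on the other, is worth a factor [capped_sum 0].  The
induction starts for [p = 0] with the symmetry, which then also exchanges [p] and
[q] to give the start for the other values of [p]. *)
Lemma plain_sum_transfer p q B : B \subset D ->
  plain_sum p.+2 q.+1 B = plain_sum p.+1 q.+2 B.
Proof.
have step p' q' : (forall B', B' \subset D ->
    plain_sum p'.+2 q'.+1 B' = plain_sum p'.+1 q'.+2 B') ->
    forall B', B' \subset D -> plain_sum p'.+2 q'.+2 B' = plain_sum p'.+1 q'.+3 B'.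
  move=> IH B' BD; have sub S : S \subset B' -> S \subset D.
    by move=> SB; apply: subset_trans BD.
  rewrite (plain_sum_peel _ _ BD) [RHS](plain_sum_peel _ _ BD); apply: (congr2 +%R).
    by apply: eq_conv => S SB; [|apply: IH; apply: sub].
  transitivity (conv (conv (capped_sum p'.+1) (capped_sum 0)) (plain_sum 0 q'.+1) B').
    by apply: eq_conv => S SB; [rewrite (capped_sum_peel _ (sub S SB)) convC|].
  rewrite -convA; apply: eq_conv => S SB; first by [].
  by rewrite (plain_sum0_peel _ (sub S SB)).
have base q' : forall B', B' \subset D -> plain_sum 2 q'.+1 B' = plain_sum 1 q'.+2 B'.
  elim: q' => [|q' IH]; first by move=> B' _; apply: plain_sum_sym.
  exact: step.
elim: q B => [|q IH]; last exact: step.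
case: p => [|p] B BD; first exact: base.
by rewrite plain_sum_sym [RHS]plain_sum_sym (base _ _ BD).
Qed.

Lemma noncrossing_sum_transfer : (1 < k a)%N ->
  noncrossing_sum [::] k =
  noncrossing_sum [::] (fun l => if l == c then (k c).+1 else if l == a then (k a).-1
      else k l).
Proof.
move=> ka; transitivity (plain_sum (k a) (k c) D).
  apply: eq_noncrossing_sum => l; rewrite /content_with !inE.
  by case: eqVneq => [->|_] //; case: eqVneq => [->|_].
have := k_gt0 c; case: (k a) ka => [|[|p]] // _; case: (k c) => [|q] // _.
rewrite plain_sum_transfer //; apply: eq_noncrossing_sum => l;
    rewrite /content_with !inE.
by case: (l == c); case: (l == a).
Qed.

End Transfer.

(** Swaps of consecutive letters bring the multiplicity of [l] down to the second
smallest letter, where one copy is transferred. *)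
Lemma noncrossing_sum_move m (k : 'I_m.+1 -> nat) (l : 'I_m.+1) :
  (forall i, 0 < k i)%N -> l != ord0 -> (1 < k l)%N ->
  exists k' : 'I_m.+1 -> nat, [/\ forall i, (0 < k' i)%N, k' ord0 = (k ord0).+1,
    (\sum_i k' i = \sum_i k i)%N & noncrossing_sum [::] k' = noncrossing_sum [::] k].
Proof.
case: m k l => [|m] k l; first by move=> _; rewrite (ord1 l) eqxx.
have [j] := ubnP l; elim: j k l => // j IH k l lt_lj kpos l0 kl.
have [l1|l1] := eqVneq l (lift ord0 ord0).
  rewrite l1 in kl; exists (fun i => if i == ord0 then (k ord0).+1
      else if i == lift ord0 ord0 then (k (lift ord0 ord0)).-1 else k i); split.
  - move=> i; case: ifP => // _; case: ifP => // _.
    by case: (k _) kl => [|[]].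
  - by rewrite eqxx.
  - rewrite !big_ord_recl /= !addnA; congr (_ + _)%N.
    by case: (k _) kl => [|p] //= _; rewrite addnS.
  - by rewrite -noncrossing_sum_transfer.
have [l' ll'] : exists l' : 'I_m.+2, l = l'.+1 :> nat.
  case: l l0 {l1 kl lt_lj} => [[|i] lti] // _.
  by exists (Ordinal (ltnW lti)).
have l'0 : l' != ord0.
  by apply: contraNneq l1 => l'0; apply/eqP/val_inj; rewrite /= ll' l'0.
have [||||k' [k'pos k'0 k's k'q]] := IH (swapk l l' k) l'.
- by rewrite -ltnS -ll'.
- by move=> i; apply: kpos.
- by [].
- by rewrite /swapk tpermR.
exists k'; split=> //.
- by rewrite k'0 /swapk tpermD.
- by rewrite k's sum_swapk.
- rewrite k'q /noncrossing_sum [RHS](noncrossing_sum_swap ll') //.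
  by move=> w w' sw dw; rewrite !cats0; apply: desc_weight_descents.
Qed.

(** Each move gives one more copy to the smallest letter, until all the other
letters occur once. *)
Lemma noncrossing_sum_canonical m (k : 'I_m.+1 -> nat) : (forall i, 0 < k i)%N ->
  noncrossing_sum [::] k = noncrossing_sum [::] (@one_repeated m (\sum_i k i - m)).
Proof.
have [e] := ubnP (\sum_i k i - k ord0)%N; elim: e k => // e IH k lt_e kpos.
have [/forallP k1|/forallPn[l]] := boolP [forall l, (l != ord0) ==> (k l == 1%N)].
  apply: eq_noncrossing_sum => l; rewrite /one_repeated; case: eqVneq => [->|l0].
    rewrite big_ord_recl (eq_bigr (fun=> 1%N)) ?sum1_card ?card_ord ?addnK //.
    by move=> i _; apply/eqP; apply: (implyP (k1 (lift ord0 i))).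
  by apply/eqP/(implyP (k1 l)).
rewrite negb_imply => /andP[l0 kl].
have [|k' [k'pos k'0 k's <-]] := noncrossing_sum_move kpos l0.
  by have := kpos l; case: (k l) kl => [|[]].
rewrite -k's; apply: IH => //.
rewrite k's k'0; have : (k ord0 < \sum_i k i)%N; last by move: lt_e; lia.
by rewrite (bigD1 ord0) //= (bigD1 l) //= -[X in (X < _)%N]addn0 ltn_add2l addn_gt0
    kpos.
Qed.

(** * Sums over all words, by the first block *)

Section FirstBlock.
Variable n : nat.
Implicit Types (k : 'I_n -> nat) (w u v : seq 'I_n) (S : {set 'I_n}).

Definition word_sum k : tpoly := \sum_(w <- words k) desc_weight w.

Lemma eq_word_sum k1 k2 : k1 =1 k2 -> word_sum k1 = word_sum k2.
Proof. by move=> /eq_words e; rewrite /word_sum e. Qed.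

Definition decr_enum S : seq 'I_n := [seq l <- rev (enum 'I_n) | l \in S].

Lemma mem_decr_enum S : decr_enum S =i S.
Proof. by move=> l; rewrite mem_filter mem_rev mem_enum andbT. Qed.

Lemma decr_trans : transitive (@decr n).
Proof. by move=> y x z yx zy; apply: ltn_trans yx. Qed.

Lemma decr_enum_sorted S : sorted (@decr n) (decr_enum S).
Proof.
apply: sorted_filter; first exact: decr_trans.
by have := iota_ltn_sorted 0 n; rewrite rev_sorted -val_enum_ord sorted_map.
Qed.

Lemma size_decr_enum S : size (decr_enum S) = #|S|.
Proof.
rewrite -(card_uniqP (sorted_decr_uniq (decr_enum_sorted S))).
by apply: eq_card => l; rewrite mem_decr_enum.
Qed.

Lemma decr_enum_eq u : sorted (@decr n) u -> decr_enum [set l in u] = u.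
Proof.
move=> srt; apply: (irr_sorted_eq decr_trans _ (decr_enum_sorted _) srt).
  by move=> l; rewrite /decr ltnn.
by move=> l; rewrite mem_decr_enum inE.
Qed.

Definition remove_letters S k := fun l => (k l - (l \in S))%N.

(** The set of letters of a first block of size [m] and the remaining word
determine the word and [m], because the block is decreasing. *)
Lemma word_sum_rec_nonempty k : (0 < \sum_l k l)%N ->
  word_sum k = \sum_(S : {set 'I_n} | (S \subset [set l | (0 < k l)%N]) && (S != set0))
     Wbar #|S| * word_sum (remove_letters S k).
Proof.
move=> k0.
have wrec w : w \in words k -> desc_weight w =
    \sum_(m <- [seq m <- iota 1 (size w) | sorted (@decr n) (take m w)])
       Wbar m * desc_weight (drop m w).
  move=> kw; rewrite big_filter desc_weight_rec; last first.
    by rewrite -size_eq0 (words_size kw) -lt0n.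
  by rewrite /index_iota subSS subn0.
rewrite /word_sum (eq_big_seq _ wrec).
rewrite -(big_allpairs_dep (h := fun (w : seq 'I_n) (m : nat) => (w, m))
  (F := fun wm => Wbar wm.2 * desc_weight (drop wm.2 wm.1))).
under [RHS]eq_bigr do rewrite mulr_sumr.
rewrite -[RHS]big_filter.
rewrite -(big_allpairs_dep (h := fun S (v : seq 'I_n) => (S, v))
  (F := fun Sv => Wbar #|Sv.1| * desc_weight Sv.2)).
(* A word with a decreasing prefix of size [m] corresponds to the set of letters
   of the prefix with the rest of the word. *)
pose f (wm : seq 'I_n * nat) := ([set l in take wm.2 wm.1], drop wm.2 wm.1).
pose g (Sv : {set 'I_n} * seq 'I_n) := (decr_enum Sv.1 ++ Sv.2, #|Sv.1|).
apply: (big_seq_bij (f := f) (g := g)).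
- apply: allpairs_uniq_dep; rewrite ?words_uniq //.
    by move=> w _; rewrite filter_uniq ?iota_uniq.
  by move=> [? ?] [? ?] _ _ /= [-> ->].
- apply: allpairs_uniq_dep; rewrite ?filter_uniq ?index_enum_uniq //.
    by move=> S _; rewrite words_uniq.
  by move=> [? ?] [? ?] _ _ /= [-> ->].
- move=> _ /allpairsPdep[w [m [kw + ->]]].
  rewrite mem_filter mem_iota add1n ltnS => /and3P[srt m_gt0 le_mw].
  have cardS : #|[set l in take m w]| = m.
    rewrite -size_decr_enum decr_enum_eq // size_takel //.
  rewrite /f /g /= cardS decr_enum_eq // cat_take_drop; split=> //.
  apply/allpairsPdep; exists [set l in take m w], (drop m w); split=> //.
    rewrite mem_filter mem_index_enum andbT; apply/andP; split.
      apply/subsetP => l; rewrite !inE => /mem_take.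
      by rewrite (mem_words _ kw).
    by rewrite -card_gt0 cardS.
  apply/wordsP => l; rewrite /remove_letters inE; have /wordsP/(_ l) <- := kw.
  rewrite -{2}(cat_take_drop m w) count_cat.
  by rewrite (count_uniq_mem _ (sorted_decr_uniq srt)) addKn.
move=> _ /allpairsPdep[S [v [+ kv ->]]]; rewrite mem_filter mem_index_enum andbT.
move=> /andP[Sk S0]; rewrite /f /g /= -size_decr_enum take_size_cat // drop_size_cat //.
split; last first.
  by congr (_, _); apply/setP => l; rewrite inE mem_decr_enum.
apply/allpairsPdep; exists (decr_enum S ++ v), (size (decr_enum S)); split=> //.
  apply/wordsP => l; rewrite count_cat.
  rewrite count_uniq_mem ?(sorted_decr_uniq (decr_enum_sorted S)) // mem_decr_enum.
  have /wordsP/(_ l) -> := kv; rewrite /remove_letters subnKC //.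
  by case lS: (l \in S) => //; have := subsetP Sk l lS; rewrite inE.
rewrite mem_filter take_size_cat // decr_enum_sorted mem_iota add1n ltnS.
by rewrite size_cat leq_addr andbT size_decr_enum card_gt0.
Qed.

(** [Wbar 0 = -1] has no combinatorial meaning; with the value [0], sums over
blocks may include the empty set. *)
Definition Wbar_pos m : tpoly := if m == 0%N then 0 else Wbar m.

Lemma word_sum_rec k : (0 < \sum_l k l)%N ->
  word_sum k = \sum_(S : {set 'I_n} | S \subset [set l | (0 < k l)%N])
     Wbar_pos #|S| * word_sum (remove_letters S k).
Proof.
move=> /word_sum_rec_nonempty ->; rewrite [RHS](bigID (fun S => S != set0)).
rewrite [X in _ = _ + X]big1 ?addr0 => [|S /andP[_]].
  apply: eq_bigr => S /andP[_ S0].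
  by rewrite /Wbar_pos cards_eq0 (negPf S0).
by rewrite negbK => /eqP->; rewrite cards0 /Wbar_pos eqxx mul0r.
Qed.

Lemma word_sum0 k : k =1 (fun=> 0%N) -> word_sum k = 1.
Proof.
move=> k0; rewrite /word_sum (_ : words k = [:: [::]]) ?big_seq1 ?desc_weight_nil //.
rewrite /words (_ : letters k = [::]) //; apply/eqP; rewrite -size_eq0 size_letters.
by rewrite big1.
Qed.

(** The repeated letter [l0] is arbitrary: with [k0 = 0] or [k0 = 1] this allows
one to change which letter is the repeated one. *)
Definition content_one (l0 : 'I_n) (k0 : nat) S (l : 'I_n) : nat :=
  if l == l0 then k0 else l \in S.

Lemma sum_content_one l0 (k0 : nat) S : l0 \notin S ->
  (\sum_l content_one l0 k0 S l = k0 + #|S|)%N.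
Proof.
move=> l0S; rewrite (bigD1 l0) //= /content_one eqxx; congr addn.
rewrite -sum1_card [RHS]big_mkcond [RHS](bigD1 l0) //= (negPf l0S) add0n.
by apply: eq_bigr => l /negPf->; case: (l \in S).
Qed.

Lemma sum_card_subset (R : nmodType) S (F : nat -> R) :
  \sum_(U : {set 'I_n} | U \subset S) F #|U| =
  \sum_(m < #|S|.+1) F m *+ 'C(#|S|, m).
Proof.
rewrite (partition_big (fun U : {set 'I_n} => inord #|U| : 'I_#|S|.+1) xpredT) //=.
apply: eq_bigr => m _; rewrite -cards_draws -sumr_const.
apply: eq_big => [U|U /andP[US /eqP <-]]; last first.
  by rewrite inordK // ltnS subset_leq_card.
rewrite inE; case US: (U \subset S) => //=.
by rewrite -val_eqE /= inordK // ltnS subset_leq_card.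
Qed.

(** The first sum collects the first blocks without [l0], the second one those
that contain [l0]. *)
Lemma word_sum_content_one_rec l0 (k0 : nat) S : l0 \notin S -> (0 < k0 + #|S|)%N ->
  word_sum (content_one l0 k0 S) =
  \sum_(U : {set 'I_n} | U \subset S) Wbar_pos #|U| *
      word_sum (content_one l0 k0 (S :\: U)) +
  (if k0 is k1.+1 then
     \sum_(U : {set 'I_n} | U \subset S) Wbar #|U|.+1 *
         word_sum (content_one l0 k1 (S :\: U))
   else 0).
Proof.
move=> l0S pos; rewrite word_sum_rec ?sum_content_one //.
have l0U (U : {set 'I_n}) : U \subset S -> l0 \notin U by move=> US;
    apply: contra l0S; apply: (subsetP US).
have E1 (U : {set 'I_n}) : U \subset S ->
    word_sum (remove_letters U (content_one l0 k0 S)) =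
    word_sum (content_one l0 k0 (S :\: U)).
  move=> US; apply: eq_word_sum => l; rewrite /remove_letters /content_one.
  case: eqVneq => [->|_]; first by rewrite (negPf (l0U _ US)) subn0.
  by rewrite inE; case lU: (l \in U); rewrite ?(subsetP US _ lU) // subn0.
case: k0 pos E1 => [|k'] pos E1.
  have -> : [set l | (0 < content_one l0 0 S l)%N] = S.
    apply/setP => l; rewrite inE /content_one.
    by case: eqVneq => [->|_]; [rewrite (negPf l0S)|case: (l \in S)].
  by rewrite addr0; apply: eq_bigr => U US; rewrite E1.
have -> : [set l | (0 < content_one l0 k'.+1 S l)%N] = l0 |: S.
  apply/setP => l; rewrite inE in_setU1 /content_one.
  have [_|_] := eqVneq l l0; first by [].
  by case: (l \in S).
rewrite [LHS](sum_subsetU1 _ l0S).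
rewrite -big_split.
apply: eq_bigr => U US.
rewrite (E1 _ US) cardsU1 (l0U _ US) add1n; apply: (congr2 +%R); first by [].
apply: (congr2 *%R); first by [].
apply: eq_word_sum => l; rewrite /remove_letters /content_one in_setU1.
have [->|_] := eqVneq l l0; first by rewrite subn1.
by rewrite inE; case lU: (l \in U); rewrite ?(subsetP US _ lU) // subn0.
Qed.

End FirstBlock.

(** The recurrence as a function of the number [j] of simple letters and the
multiplicity [k0]; it shows that the sum over the words does not depend on the
alphabet nor on the chosen letters.  The fuel bounds the length of the words. *)
Fixpoint p_fuel (fuel j k0 : nat) : tpoly :=
  if fuel is f.+1 then
    if (j + k0 == 0)%N then 1 else
      \sum_(m < j.+1) (Wbar_pos m * p_fuel f (j - m) k0) *+ 'C(j, m) +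
      (if k0 is k1.+1 then
         \sum_(m < j.+1) (Wbar m.+1 * p_fuel f (j - m) k1) *+ 'C(j, m)
       else 0)
  else 1.

Lemma word_sum_p_fuel fuel n (l0 : 'I_n) (k0 : nat) (S : {set 'I_n}) :
  l0 \notin S -> (#|S| + k0 <= fuel)%N ->
  word_sum (content_one l0 k0 S) = p_fuel fuel #|S| k0.
Proof.
elim: fuel k0 S => [|f IH] k0 S l0S le_f.
  rewrite word_sum0 // => l; rewrite /content_one.
  move: le_f; rewrite leqn0 addn_eq0 cards_eq0 => /andP[/eqP-> /eqP->].
  by rewrite inE; case: ifP.
rewrite /=; have [/eqP|pos] := eqVneq (#|S| + k0)%N 0%N.
  rewrite addn_eq0 cards_eq0 => /andP[/eqP-> /eqP->].
  by rewrite word_sum0 // => l; rewrite /content_one inE; case: ifP.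
rewrite word_sum_content_one_rec //; last by rewrite lt0n addnC.
have cardD (U : {set 'I_n}) : U \subset S -> #|S :\: U| = (#|S| - #|U|)%N.
  by move=> US; rewrite cardsD (setIidPr US).
have notD (U : {set 'I_n}) : l0 \notin S :\: U by rewrite inE negb_and l0S orbT.
apply: (congr2 +%R).
  rewrite -(sum_card_subset S (fun m => Wbar_pos m * p_fuel f (#|S| - m) k0)).
  apply: eq_bigr => U US; have [U0|U0] := eqVneq #|U| 0%N.
    by rewrite U0 /Wbar_pos !mul0r.
  rewrite (IH _ _ (notD U)) cardD //.
  by move: le_f (subset_leq_card US) U0; lia.
case: k0 le_f {pos} => // k1 le_f.
rewrite -(sum_card_subset S (fun m => Wbar m.+1 * p_fuel f (#|S| - m) k1)).
apply: eq_bigr => U US; rewrite (IH _ _ (notD U)) cardD //.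
by move: le_f; lia.
Qed.

Lemma sum_multiperms n (k : 'I_n -> nat) (P : pred (seq 'I_n)) (F : seq 'I_n -> tpoly) :
  \sum_(w in multiperms k | P (val w)) F (val w) = \sum_(w <- words k | P w) F w.
Proof.
rewrite -big_enum_cond -(big_map val P F); apply: perm_big; apply: uniq_perm.
- by rewrite map_inj_uniq ?enum_uniq //; apply: val_inj.
- exact: words_uniq.
move=> w; apply/mapP/idP => [[t + ->]|kw].
  rewrite mem_enum inE => /forallP kt; apply/wordsP => l.
  by apply/eqP; apply: kt.
have sw : size w == (\sum_(l < n) k l)%N by rewrite (words_size kw).
exists (Tuple sw) => //; rewrite mem_enum inE; apply/forallP => l /=.
by have /wordsP/(_ l) -> := kw.
Qed.

(** The alphabet size is one more than the number [j] of simple letters. *)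
Definition p_nat (j k : nat) : tpoly := p_one (Posz j.+1) (Posz k).

Lemma p_nat_word_sum j k : p_nat j k = word_sum (@one_repeated j k).
Proof.
rewrite /p_nat /p_one /word_sum.
rewrite -(sum_multiperms (@one_repeated j k) xpredT (fun w => desc_weight w)).
by apply: eq_bigl => w; rewrite andbT.
Qed.

Lemma p_nat_fuel fuel j k : (j + k <= fuel)%N -> p_nat j k = p_fuel fuel j k.
Proof.
pose S : {set 'I_j.+1} := ~: [set ord0].
have cS : #|S| = j by rewrite cardsC1 card_ord.
move=> le_f; rewrite p_nat_word_sum (@eq_word_sum _ _ (content_one ord0 k S)) => [|l].
  have oS : ord0 \notin S by rewrite !inE eqxx.
  by rewrite (word_sum_p_fuel (fuel := fuel) oS) ?cS.
by rewrite /one_repeated /content_one !inE; case: (l == ord0).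
Qed.

Lemma p_nat_rec j k :
  p_nat j k = ((j + k == 0)%N)%:R +
    \sum_(m < j.+1) (Wbar_pos m * p_nat (j - m) k) *+ 'C(j, m) +
    (if k is k1.+1 then
       \sum_(m < j.+1) (Wbar m.+1 * p_nat (j - m) k1) *+ 'C(j, m) else 0).
Proof.
rewrite (p_nat_fuel (leqnSn (j + k))) /=; have [|pos] := eqVneq (j + k)%N 0%N.
  case: j => // ; case: k => // _.
  by rewrite big_ord1 /Wbar_pos mul0r mul0rn !addr0.
rewrite add0r; apply: (congr2 +%R).
  apply: eq_bigr => m _; have [m0|m0] := eqVneq (val m) 0%N.
    by rewrite /= in m0; rewrite m0 /Wbar_pos !mul0r.
  by rewrite (@p_nat_fuel (j + k)) // leq_add2r leq_subr.
case: k {pos} => [|k1]; first by [].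
apply: eq_bigr => m _.
rewrite (@p_nat_fuel (j + k1.+1) (j - m) k1); first by [].
by rewrite addnS ltnW // ltnS leq_add2r leq_subr.
Qed.

(** A simple letter is a letter repeated once: both sides are sums over the words
on [j + 1] distinct letters. *)
Lemma p_nat_k0 j : p_nat j.+1 0 = p_nat j 1.
Proof.
rewrite p_nat_word_sum (@p_nat_fuel j.+1) ?addn1 //.
set l1 : 'I_j.+2 := lift ord0 ord0; set S := ~: [set ord0; l1].
have cS : #|S| = j.
  by rewrite cardsCs setCK cards2 card_ord -[ord0 != l1]/true subn2.
rewrite -[in RHS]cS -(word_sum_p_fuel (l0 := l1)); last first.
- by rewrite cS addn1.
- by rewrite !inE eqxx orbT.
apply: eq_word_sum => l; rewrite /one_repeated /content_one !inE.
have [->|_] := eqVneq l l1; first by [].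
by rewrite orbF; case: (l == ord0).
Qed.

(** * The exponential generating function *)

Lemma coef_mulC (A : comNzRingType) (F : fps A) (g : A) k :
  fps_coef (F * fpsC g) k = fps_coef F k * g.
Proof.
rewrite /= big_ord_recr /= subnn eqxx big1 ?add0r // => i _.
by rewrite subn_eq0 leqNgt ltn_ord mulr0.
Qed.

Lemma coef_mulX (A : comNzRingType) (F : fps A) k :
  fps_coef (F * fpsX) k = if k is k1.+1 then fps_coef F k1 else 0.
Proof.
case: k => [|k]; first by rewrite /= big_ord1 /= mulr0.
rewrite /= !big_ord_recr /= subnn mulr0 addr0 subSnn mulr1 big1 ?add0r // => i _.
have := ltn_ord i; rewrite -subn_gt0 subSn; last exact: ltnW.
by case: (k - i)%N => //= d _; rewrite mulr0.
Qed.

Lemma coefB (A : comNzRingType) (f g : fps A) i :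
  fps_coef (f - g) i = fps_coef f i - fps_coef g i.
Proof. by []. Qed.

Lemma coef_mul_linear (A : comNzRingType) (P : fps A) (u v : A) k :
  fps_coef (P * (1 - fpsC u - fpsX * fpsC v)) k =
  fps_coef P k - fps_coef P k * u - (if k is k1.+1 then fps_coef P k1 else 0) * v.
Proof.
by rewrite !mulrBr mulr1 mulrA coefB coefB coef_mulC coef_mulC coef_mulX.
Qed.

Lemma bin_inv_fact j m : (m <= j)%N ->
  ((j`!%:R^-1 : rat) *+ 'C(j, m)) = (j - m)`!%:R^-1 * m`!%:R^-1.
Proof.
move=> le_mj; have f0 i : (i`!%:R : rat) != 0 by rewrite Num.Theory.pnatr_eq0 -lt0n
    fact_gt0.
have C0 : ('C(j, m)%:R : rat) != 0 by rewrite Num.Theory.pnatr_eq0 -lt0n bin_gt0.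
rewrite -mulr_natr -(bin_fact le_mj) !natrM; field.
by rewrite C0 !f0.
Qed.

(** The series [f] has the extra factor [x], so the coefficient of index [j + 1]
is a binomial convolution of order [j]. *)
Lemma egf_coef_mul (U V : nat -> tpoly) j (f g : fps tpoly) :
  fps_coef f 0 = 0 -> (forall i, fps_coef f i.+1 = (i`!%:R^-1 : rat) *: U i) ->
  (forall i, fps_coef g i = (i`!%:R^-1 : rat) *: V i) ->
  fps_coef (f * g) j.+1 =
  (j`!%:R^-1 : rat) *: \sum_(m < j.+1) (V m * U (j - m)%N) *+ 'C(j, m).
Proof.
move=> f0 fE gE; rewrite /= big_ord_recl f0 /= mul0r add0r scaler_sumr.
rewrite (reindex_inj rev_ord_inj) /=; apply: eq_bigr => m _.
rewrite fE gE /= /bump /= add1n !subSS subKn ?leq_ord // -scalerMnr scalerMnl.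
rewrite bin_inv_fact ?leq_ord // -scalerAl -scalerAr scalerA.
by rewrite [U _ * _]mulrC.
Qed.

(** Multiplying by the denominator, the coefficient of [x^(j+1) y^k] is [1/j!]
times the recurrence [p_nat_rec]; the inhomogeneous term gives [x]. *)
Lemma Pegf_eq : Pegf = xvar / (1 - fpsC Wegf - yvar * fpsC (fps_deriv Wegf)).
Proof.
apply: (canRL (mulrK egf_den_unit)).
apply: fpsP => k; rewrite /yvar (coef_mul_linear Pegf Wegf (fps_deriv Wegf) k).
have P0 k' : fps_coef (fps_coef Pegf k') 0 = 0 by [].
have PE k' i : fps_coef (fps_coef Pegf k') i.+1 = (i`!%:R^-1 : rat) *: p_nat i k'.
  by [].
have WE i : fps_coef Wegf i = (i`!%:R^-1 : rat) *: Wbar_pos i.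
  by rewrite /Wbar_pos /=; case: (i == 0%N); rewrite ?scaler0.
have W'E i : fps_coef (fps_deriv Wegf) i = (i`!%:R^-1 : rat) *: Wbar i.+1.
  have F : (i.+1`!%:R^-1 : rat) *+ i.+1 = i`!%:R^-1.
    rewrite -[LHS]mulr_natl factS natrM invfM mulrA mulfV ?mul1r //.
    by rewrite Num.Theory.pnatr_eq0.
  transitivity ((i.+1`!%:R^-1 : rat) *: Wbar i.+1 *+ i.+1); first by [].
  by rewrite scalerMnl F.
have sub3 (a b c a' b' c' r : tpoly) :
    a = a' -> b = b' -> c = c' -> a' - b' - c' = r -> a - b - c = r.
  by move=> -> -> ->.
have c0 (f g : fps tpoly) : fps_coef f 0 = 0 -> fps_coef (f * g) 0 = 0.
  by move=> f0; rewrite /= big_ord1 f0 mul0r.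
apply: fpsP => -[|j]; rewrite coefB coefB.
  apply: (sub3 _ _ _ 0 0 0 _ (P0 k)); first exact: c0.
    by apply: c0; case: k.
  by rewrite !subr0 /xvar; case: k.
pose N := (if k is k1.+1 then
    \sum_(m < j.+1) (Wbar m.+1 * p_nat (j - m) k1) *+ 'C(j, m) else 0).
apply: (sub3 _ _ _ _ _ ((j`!%:R^-1 : rat) *: N) _ (PE k j)
  (egf_coef_mul j (P0 k) (PE k) WE)).
  rewrite /N; case: (k) => [|k1]; last exact: (egf_coef_mul j (P0 k1) (PE k1) W'E).
  by rewrite mul0r scaler0.
rewrite -!scalerBr (p_nat_rec j k) -/N.
have cancel (x y z : tpoly) : x + y + z - y - z = x by ring.
rewrite cancel /N /xvar; case: (k) => [|k1]; last by rewrite addnS scaler0.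
case: (j) => [|j']; last by rewrite scaler0.
by rewrite fact0 invr1 scale1r.
Qed.

Lemma p_one_recurrence n k : (1 <= n)%N -> (1 <= k)%N ->
  p_one n%:Z k%:Z =
    \sum_(1 <= m < n.+1)
       Wbar m * ('C(n.-1, m)%:R * p_one (n%:Z - m%:Z) k%:Z
                 + 'C(n.-1, m.-1)%:R
                   * p_one (n%:Z - m%:Z + 1) (k%:Z - 1)).
Proof.
case: n k => [|j] [|k] // _ _.
rewrite -/(p_nat j k.+1) p_nat_rec addnS add0r.
rewrite [RHS](eq_bigr (fun m => Wbar m * ('C(j, m)%:R *
    p_one (j.+1%:Z - m%:Z) k.+1%:Z) +
  Wbar m * ('C(j, m.-1)%:R * p_one (j.+1%:Z - m%:Z + 1) (k.+1%:Z - 1)))) => [|m _];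
      last first.
  by rewrite mulrDr.
rewrite big_split /=; apply: (congr2 +%R).
  rewrite big_ord_recl /Wbar_pos mul0r mul0rn add0r.
  rewrite big_nat_recr //= bin_small // mul0r mulr0 addr0 big_add1 big_mkord /=.
  apply: eq_bigr => i _; rewrite /= /bump /= add1n.
  rewrite subzn; last by rewrite ltnS; apply: ltnW.
  rewrite subSn // -/(p_nat (j - i.+1) k.+1).
  by rewrite -mulr_natl mulrCA.
rewrite big_add1 big_mkord /=; apply: eq_bigr => i _.
have -> : k.+1%:Z - 1 = k%:Z by rewrite -addn1 PoszD addrK.
have -> : j.+1%:Z - i.+1%:Z + 1 = (j - i).+1%:Z.
  by rewrite subzn // subSS -(addn1 (j - i)) PoszD.
by rewrite -/(p_nat (j - i) k) -mulr_natl mulrCA.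
Qed.

(** * Quasi-Stirling words and the theorem *)

(** Applied four times, it turns a subsequence [yzyz] into four increasing
positions. *)
Lemma subseq_drop_consP (T : eqType) (x0 y : T) (t s : seq T) j :
  subseq (y :: t) (drop j s) <->
  exists i, [/\ (j <= i)%N, (i < size s)%N, nth x0 s i = y &
                subseq t (drop i.+1 s)].
Proof.
split=> [|[i [le_ji lt_is <- st]]]; last first.
  apply: (@subseq_trans _ (drop i s)); last first.
    by rewrite -(subnK le_ji) -drop_drop drop_subseq.
  by rewrite (drop_nth x0 lt_is) /= eqxx.
have first_occ r : subseq (y :: t) r ->
    exists i, [/\ (i < size r)%N, nth x0 r i = y & subseq t (drop i.+1 r)].
  elim: r => //= x r IH; have [-> st|_ /IH[i [lt_i ni st]]] := eqVneq y x.
    by exists 0%N; rewrite drop0.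
  by exists i.+1.
move=> /first_occ[i [lt_i ni st]]; exists (j + i)%N; split.
- exact: leq_addr.
- by move: lt_i; rewrite size_drop; lia.
- by rewrite -nth_drop.
- by rewrite -addnS addnC -drop_drop.
Qed.

Lemma noncrossing_quasi_stirling n N (w : N.-tuple 'I_n) :
  quasi_stirling w = noncrossing (val w).
Proof.
have sw := size_tuple w.
apply/idP/noncrossingP => [qs y z yz|nc].
  have nthw (i : 'I_N) : tnth w i = nth y w i by rewrite (tnth_nth y).
  apply: contra qs; rewrite -[val w]drop0.
  move=> /(subseq_drop_consP y)[i1 [_ l1 y1 /(subseq_drop_consP y)[i2 [lt12 l2 z2]]]].
  move=> /(subseq_drop_consP y)[i3 [lt23 l3 y3 /(subseq_drop_consP y)[i4 [lt34 l4 z4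
      _]]]].
  rewrite sw in l1 l2 l3 l4.
  apply/existsP; exists (Ordinal l1); apply/existsP; exists (Ordinal l2).
  apply/existsP; exists (Ordinal l3); apply/existsP; exists (Ordinal l4).
  by rewrite !nthw /= lt12 lt23 lt34 y1 y3 z2 z4 !eqxx.
apply/negP => /existsP[j1 /existsP[j2 /existsP[j3 /existsP[j4]]]].
pose x0 := tnth w j1.
have nthw (i : 'I_N) : tnth w i = nth x0 w i by rewrite (tnth_nth x0).
rewrite !nthw => /and5P[l12 l23 l34 /eqP e13 /andP[/eqP e24 ne]].
case/negP: (nc _ _ ne); rewrite -[val w]drop0.
apply/(subseq_drop_consP x0); exists j1; rewrite sw; split=> //.
apply/(subseq_drop_consP x0); exists j2; rewrite sw; split=> //.
apply/(subseq_drop_consP x0); exists j3; rewrite sw; split=> //.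
apply/(subseq_drop_consP x0); exists j4; rewrite sw; split=> //.
exact: sub0seq.
Qed.

Lemma p_qs_noncrossing_sum n (k : 'I_n -> nat) : p_qs k = noncrossing_sum [::] k.
Proof.
rewrite /noncrossing_sum -(sum_multiperms k (@noncrossing 'I_n) (fun w =>
    desc_weight (w ++ [::]))).
apply: eq_big => [w|w _]; last by rewrite cats0.
by rewrite inE noncrossing_quasi_stirling.
Qed.

(** A crossing needs two letters that both occur twice. *)
Lemma word_sum_one_repeated j k : word_sum (@one_repeated j k) =
    noncrossing_sum [::] (@one_repeated j k).
Proof.
rewrite /word_sum /noncrossing_sum [RHS]big_mkcond; apply: eq_big_seq => w kw;
    rewrite cats0.
have -> // : noncrossing w.
apply/noncrossingP => y z yz; apply/negP => s4.
have cnt x : (count_mem x [:: y; z; y; z] <= one_repeated k x)%N.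
  have /wordsP <- := kw; exact: leq_count_subseq s4.
move: (cnt y) (cnt z); rewrite /= !eqxx (eq_sym z) (negPf yz) /one_repeated.
by case: eqVneq => [y0|_]; case: eqVneq => [z0|_] //; rewrite y0 z0 eqxx in yz.
Qed.

Theorem theorem4p6 :
  (forall (n : nat) (k : 'I_n -> nat),
     (1 <= n)%N -> (forall l : 'I_n, (0 < k l)%N) ->
     p_qs k = p_one n%:Z ((\sum_(l < n) k l)%N%:Z - n%:Z + 1))
  /\ (forall n k : nat, (1 <= n)%N -> (1 <= k)%N ->
     p_one n%:Z k%:Z =
       \sum_(1 <= m < n.+1)
          Wbar m * ('C(n.-1, m)%:R * p_one (n%:Z - m%:Z) k%:Z
                    + 'C(n.-1, m.-1)%:R
                      * p_one (n%:Z - m%:Z + 1) (k%:Z - 1)))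
  /\ (forall n : nat, (2 <= n)%N -> p_one n%:Z 0 = p_one (n%:Z - 1) 1)
  /\ p_one 1 0 = 1
  /\ (forall n k : int, n <= 0 \/ k < 0 -> p_one n k = 0)
  /\ Pegf = xvar / (1 - fpsC Wegf - yvar * fpsC (fps_deriv Wegf)).
Proof.
split.
  case=> [//|m] k _ k_gt0.
  have le_mk : (m < \sum_(l < m.+1) k l)%N.
    have : (\sum_(l < m.+1) 1 <= \sum_(l < m.+1) k l)%N.
      by apply: leq_sum => l _; apply: k_gt0.
    by rewrite sum1_card card_ord.
  rewrite p_qs_noncrossing_sum (noncrossing_sum_canonical k_gt0) -word_sum_one_repeated -p_nat_word_sum /p_nat.
  congr (p_one _ _); move: (\sum_(l < m.+1) k l)%N le_mk => K lt_mK; lia.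
split; first exact: p_one_recurrence.
split; first by case=> [|[|j]] // _; rewrite -[LHS]/(p_nat j.+1 0) p_nat_k0.
split; first by rewrite -[LHS]/(p_nat 0 0) p_nat_word_sum word_sum0 // => l; rewrite ord1.
split; last exact: Pegf_eq.
case=> [[|n]|n] [k|k] // [|]; by [].
Qed.
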